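(* Consider the setting described in the context, and assume A1–A5. A sequence of alternatives $f_n=\sum_j\theta_{nj}\phi_j$ with $cn^{-r}\le\|f_n\|\le Cn^{-r}$ (constants $0<c<C$) is purely $n^{-r}$-consistent if and only if for every $\varepsilon>0$ there are $C_1=C_1(\varepsilon)$ and $n_0(\varepsilon)$ such that $$\sum_{j>C_1k_n}\theta_{nj}^2\le\varepsilon n^{-2r}\quad\text{for all }n>n_0(\varepsilon).$$
   Context: Fix $\sigma>0$, $0<r<1/2$ and an orthonormal basis $(\phi_j)_{j\ge1}$ of $\mathbb{L}_2(0,1)$. For each $n$ one observes $dY_n(t)=f(t)\,dt+\sigma n^{-1/2}dw(t)$, equivalently $y_j=\theta_j+\sigma n^{-1/2}\xi_j$, $\theta_j=\int_0^1f\phi_j$, $\xi_j$ i.i.d. $N(0,1)$; $H_0:f=0$. Weights $\kappa_{nj}^2\ge0$, $\rho_n=\sum_j\kappa_{nj}^2$, $T_n(Y_n)=\sum_j\kappa_{nj}^2y_j^2-\sigma^2n^{-1}\rho_n$, $k_n=\sup\{k:\sum_{j<k}\kappa_{nj}^2\le\rho_n/2\}$, $\kappa_n^2=\kappa_{nk_n}^2$. Assumptions: (A1) $j\mapsto\kappa_{nj}^2$ decreasing; (A2) $C_1<\sigma^{-4}n^2\sum_j\kappa_{nj}^4<C_2$; (A3) $c_1n^{-2r}\le\rho_n\le c_2n^{-2r}$; (A4) $\exists C_1>0,\lambda>1$: $\kappa^2_{n,[(1+\delta)k_n]}<C_1(1+\delta)^{-\lambda}\kappa_n^2$ for all $\delta>0,n$;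 (A5) $\kappa_{n1}^2\asymp\kappa_n^2$ and for each $c>1$ there is $C>0$ with $\kappa^2_{n,[ck_n]}\ge C\kappa_n^2$. A test generated by $T_n$ rejects $H_0$ iff $T_n$ exceeds a threshold. A (sub)sequence $f_{n_i}$ is consistent if for every $\alpha\in(0,1)$ and every sequence of tests $K_{n_i}$ generated by $T_{n_i}$ with $\alpha(K_{n_i})=\alpha(1+o(1))$, $\limsup_i\beta(K_{n_i},f_{n_i})<1-\alpha$; inconsistent if for every sequence of tests $K_{n_i}$ generated by $T_{n_i}$, $\liminf_i(\alpha(K_{n_i})+\beta(K_{n_i},f_{n_i}))\ge1$. A sequence $f_n$ is $n^{-r}$-consistent if it is consistent and $cn^{-r}<\|f_n\|<Cn^{-r}$ for some $0<c<C$. An $n^{-r}$-consistent sequence $f_n$ is purely $n^{-r}$-consistent if there is no subsequence $n_i\to\infty$ with $f_{n_i}=f_{1n_i}+f_{2n_i}$, where $f_{2n_i}$ is orthogonal to $f_{1n_i}$, $\|f_{2n_i}\|>c_1n_i^{-r}$ for some constant $c_1>0$, and $f_{2n_i}$ is inconsistent. *)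

(* Defs.v *)
(* Sequence-space formulation of the Gaussian
   white-noise model: y_j = theta_j + sigma n^{-1/2} xi_j, j >= 1.
   All sequences are functions on nat; index 0 is unused (indices j >= 1). *)
From HB Require Import structures.
From mathcomp Require Import all_boot all_order all_algebra.
From mathcomp Require Import all_classical all_reals all_analysis.
Set Implicit Arguments.
Unset Strict Implicit.
Unset Printing Implicit Defensive.
Import Order.TTheory GRing.Theory Num.Theory.
Import numFieldNormedType.Exports.
Local Open Scope classical_set_scope.
Local Open Scope ring_scope.

Section Model.
Context {R : realType} {d : measure_display} {Omega : measurableType d}.
Variable P : probability Omega R.

Definition iid_std_normal (xi : nat -> Omega -> R) : Prop :=
  (forall j, measurable_fun setT (xi j)) /\
  (forall j (B : set R), measurable B ->
      P (xi j @^-1` B) = normal_prob 0 1 B) /\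
  (forall (s : seq nat) (B : nat -> set R), uniq s ->
      (forall i, measurable (B i)) ->
      P (\bigcap_(i in [set i | i \in s]) (xi i @^-1` B i)) =
      (\big[*%E/1%E]_(i <- s) P (xi i @^-1` B i))%E).

Definition npow (n : nat) (a : R) : R := (n%:R) `^ a.

Definition sqsum (th : nat -> R) : \bar R := (\sum_(1 <= j <oo) ((th j) ^+ 2)%:E)%E.
Definition is_l2 (th : nat -> R) : Prop := (sqsum th < +oo)%E.
Definition l2norm (th : nat -> R) : R := Num.sqrt (fine (sqsum th)).

Section Test.
Variables (xi : nat -> Omega -> R) (sigma : R) (kap2 : nat -> nat -> R).

Definition rho (n : nat) : \bar R := (\sum_(1 <= j <oo) (kap2 n j)%:E)%E.

Definition Tstat (n : nat) (th : nat -> R) (w : Omega) : \bar R :=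
  ((\sum_(1 <= j <oo)
      (kap2 n j * (th j + sigma * (Num.sqrt n%:R)^-1 * xi j w) ^+ 2)%:E)
   - (sigma ^+ 2 / n%:R * fine (rho n))%:E)%E.

Definition reject (n : nat) (t : R) (th : nat -> R) : set Omega :=
  [set w | (t%:E < Tstat n th w)%E].

Definition alpha_err (n : nat) (t : R) : R :=
  fine (P (reject n t (fun _ => 0))).
Definition beta_err (n : nat) (t : R) (th : nat -> R) : R :=
  fine (P (~` reject n t th)).

(* g i is the alternative (coefficient sequence) used at sample size ns i;
   t i is the threshold of the test K_{ns i}. *)
Definition consistent (ns : nat -> nat) (g : nat -> nat -> R) : Prop :=
  forall a : R, 0 < a < 1 ->
  forall t : nat -> R,
    (fun i => alpha_err (ns i) (t i) / a) @ \oo --> (1 : R) ->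
    (limn_esup (fun i => (beta_err (ns i) (t i) (g i))%:E) < (1 - a)%:E)%E.

Definition inconsistent (ns : nat -> nat) (g : nat -> nat -> R) : Prop :=
  forall t : nat -> R,
    (1%:E <= limn_einf (fun i =>
        (alpha_err (ns i) (t i) + beta_err (ns i) (t i) (g i))%:E))%E.

Definition nr_consistent (r : R) (th : nat -> nat -> R) : Prop :=
  consistent id th /\
  exists c C : R, 0 < c < C /\
    forall n, (0 < n)%N ->
      is_l2 (th n) /\ c * npow n (- r) < l2norm (th n) < C * npow n (- r).

Definition purely_nr_consistent (r : R) (th : nat -> nat -> R) : Prop :=
  nr_consistent r th /\
  ~ (exists ns : nat -> nat,
       {homo ns : m n / (m < n)%N >-> (m < n)%N} /\
       exists (c1 : R) (f1 f2 : nat -> nat -> R), 0 < c1 /\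
         (forall i,
            is_l2 (f1 i) /\ is_l2 (f2 i) /\
            (forall j, (0 < j)%N -> th (ns i) j = f1 i j + f2 i j) /\
            (fun N => \sum_(1 <= j < N) f1 i j * f2 i j) @ \oo --> (0 : R) /\
            c1 * npow (ns i) (- r) < l2norm (f2 i)) /\
         inconsistent ns f2).

End Test.

Definition kn_spec (kap2 : nat -> nat -> R) (n kn : nat) : Prop :=
  \sum_(1 <= j < kn) kap2 n j <= fine (rho kap2 n) / 2 /\
  forall k', \sum_(1 <= j < k') kap2 n j <= fine (rho kap2 n) / 2 -> (k' <= kn)%N.

Definition A1 (kap2 : nat -> nat -> R) : Prop :=
  forall n i j, (0 < i)%N -> (i <= j)%N -> kap2 n j <= kap2 n i.

Definition A2 (sigma : R) (kap2 : nat -> nat -> R) : Prop :=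
  exists C1 C2 : R, 0 < C1 /\
    forall n, (0 < n)%N ->
      (C1%:E < (sigma ^- 4 * (n%:R) ^+ 2)%:E * (\sum_(1 <= j <oo) ((kap2 n j) ^+ 2)%:E)
       < C2%:E)%E.

Definition A3 (r : R) (kap2 : nat -> nat -> R) : Prop :=
  exists c1 c2 : R, 0 < c1 /\ 0 < c2 /\
    forall n, (0 < n)%N ->
      ((c1 * npow n (-2 * r))%:E <= rho kap2 n <= (c2 * npow n (-2 * r))%:E)%E.

Definition A4 (kap2 : nat -> nat -> R) (k : nat -> nat) : Prop :=
  exists (C1 lam : R), 0 < C1 /\ 1 < lam /\
    forall (delta : R) n, 0 < delta -> (0 < n)%N ->
      kap2 n (Num.truncn ((1 + delta) * (k n)%:R))
        < C1 * (1 + delta) `^ (- lam) * kap2 n (k n).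

Definition A5 (kap2 : nat -> nat -> R) (k : nat -> nat) : Prop :=
  (exists c C : R, 0 < c /\ 0 < C /\
     forall n, (0 < n)%N ->
       c * kap2 n (k n) <= kap2 n 1%N <= C * kap2 n (k n)) /\
  (forall c : R, 1 < c -> exists C : R, 0 < C /\
     forall n, (0 < n)%N ->
       C * kap2 n (k n) <= kap2 n (Num.truncn (c * (k n)%:R))).

End Model.

(* Main.v *)
(* Multiplied by n^2, the statistic becomes U + lin + mu, where
   U = sum_j a_j (xi_j^2 - 1) with a_j = n sigma^2 kappa_nj^2, lin is a linear form in
   the noise of variance at most 4 a_1 mu, and mu = n^2 sum_j kappa_nj^2 theta_j^2.
   By A1-A5, a_1 -> 0, sum_j a_j^2 is bounded, and with A = sum_(j <= k_n) a_j one has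
   A -> oo and k_n = O(A^2).  Hence detectability is governed by mu alone: alternatives
   with mu -> 0 are inconsistent and alternatives with mu bounded below are consistent.

   Both facts need only the behaviour of the law of U at scale 1, and no limit theorem:
   dilating xi_j, j <= k_n, by sqrt (1 + s / A) moves U by about s, while the chi-square
   distance between the two laws of the noise stays bounded, since it is at most
   exp (k_n s^2 / A^2).  So intervals of the same length at bounded distance have
   comparable mass under U, which gives an upper bound on the mass of short intervals
   (no power when mu -> 0) and a lower bound on the mass of intervals in a bounded
   region (power when mu is bounded below).

   Finally, by A5 a component of f_n of square norm of order n^(-2r) carried by
   j <= C k_n makes mu bounded below, and by A4 a component carried by j > i k_n has
   mu = O(1/i).  A tail that does not vanish is therefore an inconsistent orthogonal
   component; conversely, if the tails vanish, an orthogonal component f_2n of f_n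
   satisfies <f_n, f_2n> = |f_2n|^2, hence has a non-negligible head. *)
Require Import Defs.
From HB Require Import structures.
From mathcomp Require Import all_boot all_order all_algebra.
From mathcomp Require Import all_classical all_reals all_analysis.
From mathcomp Require Import measurable_realfun.
From mathcomp Require Import ring lra.
Set Implicit Arguments.
Unset Strict Implicit.
Unset Printing Implicit Defensive.
Import Order.TTheory GRing.Theory Num.Theory.
Import numFieldNormedType.Exports.
Local Open Scope classical_set_scope.
Local Open Scope ring_scope.

(** * Densities and independent normal variables *)

Section density.
Context d d' (T : measurableType d) (T' : measurableType d') (R : realType).
Variables (mu : {measure set T -> \bar R}) (nu : {measure set T' -> \bar R}).
Variables (X : T -> T') (h : T -> R).
Hypothesis mX : measurable_fun setT X.
Hypothesis mh : measurable_fun setT h.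
Hypothesis h0 : forall x, 0 <= h x.
Hypothesis nuE : forall B, measurable B ->
  (nu B = \int[mu]_(x in X @^-1` B) (h x)%:E)%E.

Import HBNNSimple.
Local Open Scope ereal_scope.

Let mpre B : measurable B -> measurable (X @^-1` B).
Proof. by move=> mB; rewrite -[X in measurable X]setTI; exact: mX. Qed.

Let density_nnsfun (f : {nnsfun T' >-> R}) :
  \int[nu]_y (f y)%:E = \int[mu]_x ((f (X x))%:E * (h x)%:E).
Proof.
have mf r : measurable (f @^-1` [set r]) by exact: measurable_sfunP.
have mfX r : measurable (X @^-1` (f @^-1` [set r])) by exact: mpre.
transitivity (\sum_(y \in range f) \int[nu]_x (y * \1_(f @^-1` [set y]) x)%:E).
  under eq_integral do rewrite fimfunE -fsumEFin//.
  rewrite ge0_integral_fsum//.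
  - by move=> y; exact/measurable_EFinP/measurable_funM.
  - by move=> y x _; rewrite nnfun_muleindic_ge0.
transitivity (\sum_(y \in range f)
    \int[mu]_x ((y * \1_(f @^-1` [set y]) (X x))%:E * (h x)%:E)); last first.
  rewrite -ge0_integral_fsum//; last 2 first.
  - move=> y; apply: emeasurable_funM; apply/measurable_EFinP => //.
    apply: measurable_funM => //; apply: measurableT_comp => //.
  - move=> y x _; apply: mule_ge0; last by rewrite lee_fin.
    exact: nnfun_muleindic_ge0.
  apply: eq_integral => x _.
  rewrite -ge0_mule_fsuml ?fsumEFin -?fimfunE// => y.
  exact: nnfun_muleindic_ge0.
apply: eq_fsbigr => r /[!inE] -[x _ <-].
under eq_integral do rewrite EFinM.
under [RHS]eq_integral do rewrite EFinM -muleA.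
rewrite ge0_integralZl_EFin//; last exact/measurable_EFinP.
rewrite ge0_integralZl_EFin//; last 2 first.
- by move=> ? _; rewrite mule_ge0 ?lee_fin.
- apply: emeasurable_funM; apply/measurable_EFinP => //.
  exact: measurableT_comp.
congr (_ * _); rewrite integral_indic// setIT nuE// [LHS]integral_mkcond.
apply: eq_integral => y _; rewrite patchE indicE/= muleC.
by rewrite -[y \in _]/(X y \in f @^-1` [set f x]); case: ifPn; rewrite ?mule1 ?mule0.
Qed.

(** [nu] is the image under [X] of the measure with density [h] with respect to [mu]. The formula is
    [nuE] for indicators and extends by linearity and monotone convergence. With [X] the identity it
    gives integrals against a normal law; with [X] a noise coordinate it yields the product rule for
    independent variables. *)
Lemma ge0_integral_density (f : T' -> \bar R) : measurable_fun setT f ->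
  (forall x, 0 <= f x) ->
  \int[nu]_y f y = \int[mu]_x (f (X x) * (h x)%:E).
Proof.
move=> mf f0.
pose f_ := nnsfun_approx measurableT mf.
have fE x : f x = limn (fun n => (f_ n x)%:E).
  by apply/esym/cvg_lim => //; exact: cvg_nnsfun_approx.
transitivity (limn (fun n => \int[nu]_y (f_ n y)%:E)).
  under eq_integral do rewrite fE.
  apply: monotone_convergence => //.
  - by move=> n; exact/measurable_EFinP.
  - by move=> n x _; rewrite lee_fin.
  - by move=> x _ a b ab; rewrite lee_fin; exact/lefP/nd_nnsfun_approx.
transitivity (limn (fun n => \int[mu]_x ((f_ n (X x))%:E * (h x)%:E))).
  by congr (limn _); apply/funext => n; exact: density_nnsfun.
rewrite -monotone_convergence//.
- apply: eq_integral => x _; apply/cvg_lim => //.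
  by apply: cvgeZr => //; exact: cvg_nnsfun_approx.
- move=> n; apply: emeasurable_funM; apply/measurable_EFinP => //.
  exact: measurableT_comp.
- by move=> n x _; rewrite mule_ge0 ?lee_fin.
- move=> x _ a b ab; rewrite lee_wpmul2r ?lee_fin//.
  exact/lefP/nd_nnsfun_approx.
Qed.
End density.

Section normal_integrals.
Context {R : realType}.
Local Notation mu := (@lebesgue_measure R).
Implicit Types (m s u v c x : R).

Lemma ge0_integral_normal_prob m s (f : R -> R) : measurable_fun setT f ->
  (forall x, 0 <= f x) ->
  (\int[normal_prob m s]_x (f x)%:E =
   \int[mu]_x (f x * normal_pdf m s x)%:E)%E.
Proof.
move=> mf f0.
rewrite (@ge0_integral_density _ _ _ _ _ mu (normal_prob m s) idfun
  (normal_pdf m s))//.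
- exact: measurable_id.
- exact: measurable_normal_pdf.
- exact: normal_pdf_ge0.
- exact/measurable_EFinP.
Qed.

Lemma integral_normal_prob_indic m s (B : set R) : measurable B ->
  (\int[normal_prob m s]_x (\1_B x)%:E = normal_prob m s B)%E.
Proof. by move=> mB; rewrite integral_indic// setIT. Qed.

Lemma normal_peakE s : 0 < s -> normal_peak s = s^-1 * normal_peak 1.
Proof.
move=> s0; rewrite /normal_peak -invfM; congr (_^-1).
rewrite -mulrnAr sqrtrM ?sqr_ge0// sqrtr_sqr gtr0_norm//.
by rewrite expr1n mul1r.
Qed.

(** Likelihood ratio of N(0, c^2) with respect to N(0, 1). *)
Definition scale_density c x : R := c^-1 * expR ((1 - c ^- 2) / 2 * x ^+ 2).

(** Tilting N(0, 1) by the exponential of a square gives a multiple of a centred normal density, so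
    the Laplace transform of a squared normal variable is read off from the total mass of that
    density. *)
Lemma normal_pdf_sqr_tilt u s x : 0 < s -> 1 - 2 * u = s ^- 2 ->
  expR (u * x ^+ 2) * normal_pdf 0 1 x = s * normal_pdf 0 s x.
Proof.
move=> s0 us; have s1 : s != 0 by rewrite gt_eqF.
have -> : u = (1 - s ^- 2) / 2 by lra.
rewrite !normal_pdfE ?oner_eq0// (normal_peakE s0) /normal_fun.
rewrite mulrCA -expRD 2!(mulrA s) mulfV// mul1r; congr (_ * expR _).
by rewrite expr1n subr0; field.
Qed.

Lemma normal_pdf_tilt v x :
  expR (v * x) * normal_pdf 0 1 x = expR (v ^+ 2 / 2) * normal_pdf v 1 x.
Proof.
rewrite !normal_pdfE ?oner_eq0// /normal_fun mulrCA [RHS]mulrCA -!expRD.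
by congr (_ * expR _); rewrite expr1n subr0; field.
Qed.

Lemma normal_pdf_scale c x : 0 < c ->
  c * (scale_density c (c * x) * normal_pdf 0 1 (c * x)) = normal_pdf 0 1 x.
Proof.
move=> c0; have c1 : c != 0 by rewrite gt_eqF.
rewrite /scale_density mulrA mulrA mulfV// mul1r.
rewrite !normal_pdfE ?oner_eq0// /normal_fun mulrCA -expRD.
by congr (_ * expR _); rewrite expr1n !subr0; field.
Qed.

Lemma normal_laplace_sqr u : u < 2^-1 ->
  (\int[normal_prob 0 1]_x (expR (u * x ^+ 2))%:E
   = ((Num.sqrt (1 - 2 * u))^-1)%:E)%E.
Proof.
move=> u12; have d0 : 0 < 1 - 2 * u by lra.
have s0 : 0 < (Num.sqrt (1 - 2 * u))^-1 by rewrite invr_gt0 sqrtr_gt0.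
set s := (Num.sqrt (1 - 2 * u))^-1 in s0 *.
have s2 : 1 - 2 * u = s ^- 2 by rewrite exprVn invrK sqr_sqrtr// ltW.
rewrite ge0_integral_normal_prob//; last first.
  by apply: measurableT_comp => //; apply: measurable_funM.
transitivity (\int[mu]_x (s%:E * (normal_pdf 0 s x)%:E))%E; last first.
  rewrite ge0_integralZl_EFin//; last by rewrite ltW.
  - by rewrite integral_normal_pdf mule1.
  - by move=> x _; rewrite lee_fin normal_pdf_ge0.
  - by apply/measurable_EFinP; exact: measurable_normal_pdf.
by apply: eq_integral => x _; rewrite -EFinM; congr (_%:E); exact: normal_pdf_sqr_tilt.
Qed.

Lemma normal_laplace v :
  (\int[normal_prob 0 1]_x (expR (v * x))%:E = (expR (v ^+ 2 / 2))%:E)%E.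
Proof.
rewrite ge0_integral_normal_prob//; last first.
  by apply: measurableT_comp => //; apply: measurable_funM.
transitivity (\int[mu]_x ((expR (v ^+ 2 / 2))%:E * (normal_pdf v 1 x)%:E))%E;
  last first.
  rewrite ge0_integralZl_EFin//.
  - by rewrite integral_normal_pdf mule1.
  - by move=> x _; rewrite lee_fin normal_pdf_ge0.
  - by apply/measurable_EFinP; exact: measurable_normal_pdf.
by apply: eq_integral => x _; rewrite -EFinM; congr (_%:E); exact: normal_pdf_tilt.
Qed.

(** Uniqueness of Lebesgue measure: the right-hand side is a measure in [A] with the same values on
    half-open intervals. *)
Lemma lebesgue_measure_scale c (A : set R) : 0 < c -> measurable A ->
  (mu A = c%:E * mu ((fun x : R => (c * x)%R) @^-1` A))%E.
Proof.
move=> c0 mA.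
have mc : measurable_fun setT (fun x : measurableTypeR R => c * x : measurableTypeR R).
  exact: measurable_funM.
pose c' : {nonneg R} := NngNum (ltW c0).
pose nu' : {measure set (measurableTypeR R) -> \bar R} :=
  mscale c' (pushforward mu (fun x : measurableTypeR R => c * x : measurableTypeR R)).
pose nu := nu' mc.
rewrite -[RHS]/(nu A); apply: lebesgue_measure_unique => //.
move=> _ [[a b]] _ <-.
rewrite -[RHS]/(c%:E * mu ((fun x : R => (c * x)%R) @^-1` `]a, b]))%E.
have -> : (fun x => c * x) @^-1` `]a, b] = `]c^-1 * a, c^-1 * b]%classic.
  apply/seteqP; split => x /=; rewrite !in_itv/= ltr_pdivrMl// ler_pdivlMl//.
rewrite !lebesgue_measure_itv/= !lte_fin ltr_pM2l ?invr_gt0//.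
case: ifPn => _; rewrite ?mule0// -!EFinB -EFinM; congr (_%:E).
by rewrite mulrBr !mulrA mulfV ?gt_eqF// !mul1r.
Qed.

Lemma scale_density_ge0 c x : 0 < c -> 0 <= scale_density c x.
Proof. by move=> c0; rewrite mulr_ge0 ?expR_ge0// invr_ge0 ltW. Qed.

Lemma scale_density1 x : scale_density 1 x = 1.
Proof. by rewrite /scale_density expr1n invr1 subrr !mul0r expR0 mul1r. Qed.

Lemma measurable_scale_density c : measurable_fun setT (scale_density c).
Proof.
apply: measurable_funM => //; apply: measurableT_comp => //.
by apply: measurable_funM => //; exact: measurable_funX.
Qed.

Lemma normal_prob_scale c (B : set R) : 0 < c -> measurable B ->
  (normal_prob 0 1 ((fun x : R => (c * x)%R) @^-1` B) =
   \int[normal_prob 0 1]_x (scale_density c x * \1_B x)%:E)%E.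
Proof.
move=> c0 mB.
have mc : measurable_fun setT (fun x : measurableTypeR R => c * x : measurableTypeR R).
  exact: measurable_funM.
rewrite ge0_integral_normal_prob; last 2 first.
- apply: measurable_funM; last exact: measurable_indic.
  exact: measurable_scale_density.
- by move=> x; rewrite mulr_ge0 ?scale_density_ge0// indicE ler0n.
pose g x : R := c * (scale_density c x * \1_B x * normal_pdf 0 1 x).
have g0 x : 0 <= g x.
  rewrite /g; apply: mulr_ge0; first exact: ltW.
  apply: mulr_ge0; last exact: normal_pdf_ge0.
  by apply: mulr_ge0; [exact: scale_density_ge0|rewrite indicE ler0n].
have mg : measurable_fun setT g.
  apply: measurable_funM => //; apply: measurable_funM; last first.
    exact: measurable_normal_pdf.
  by apply: measurable_funM => //; exact: measurable_scale_density.
pose c' : {nonneg R} := NngNum (ltW c0).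
pose nu' : {measure set (measurableTypeR R) -> \bar R} :=
  mscale c' (pushforward mu (fun x : measurableTypeR R => c * x : measurableTypeR R)).
pose nu := nu' mc.
transitivity (c^-1%:E * \int[mu]_x (g x)%:E)%E; last first.
  rewrite -ge0_integralZl_EFin//; last by rewrite invr_ge0 ltW.
  - apply: eq_integral => x _; rewrite -EFinM /g.
    by rewrite (mulrA c^-1) mulVf ?gt_eqF// mul1r.
  - by move=> x _; rewrite lee_fin.
  - exact/measurable_EFinP.
(* The substitution x -> c x: Lebesgue measure is rewritten as [c] times its image under this
   map. *)
have -> : (\int[mu]_x (g x)%:E = \int[nu]_x (g x)%:E)%E.
  apply: eq_measure_integral => A mA _; exact: lebesgue_measure_scale.
rewrite ge0_integral_mscale//; last 2 first.
- exact/measurable_EFinP.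
- by move=> x _; rewrite lee_fin.
rewrite ge0_integral_pushforward//; last 2 first.
- exact/measurable_EFinP.
- by move=> y _; rewrite lee_fin.
rewrite preimage_setT muleA -EFinM mulVf ?gt_eqF// mul1e.
rewrite /normal_prob [LHS]integral_mkcond; apply: eq_integral => x _ /=.
rewrite patchE /g indicE -[x \in _]/(c * x \in B).
case: ifPn => _; last by rewrite mulr0 mul0r mulr0.
by congr (_%:E); rewrite mulr1; exact/esym/normal_pdf_scale.
Qed.

End normal_integrals.

Section density_measure.
Context d (T : measurableType d) (R : realType).
Variables (mu : {measure set T -> \bar R}) (h : T -> R).
Hypothesis mh : measurable_fun setT h.
Hypothesis h0 : forall x, 0 <= h x.
Local Open Scope ereal_scope.

(** The two properties of [h] are arguments so that the measure structure below can be attached to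
    the term [mdensity mh h0]. *)
Definition mdensity of measurable_fun setT h & (forall x, (0 <= h x)%R) :=
  fun A : set T => \int[mu]_(x in A) (h x)%:E.

Let mdensity0 : mdensity mh h0 set0 = 0.
Proof. by rewrite /mdensity integral_set0. Qed.

Let mdensity_ge0 A : 0 <= mdensity mh h0 A.
Proof. by apply: integral_ge0 => x _; rewrite lee_fin. Qed.

Let mdensity_sigma_additive : semi_sigma_additive (mdensity mh h0).
Proof.
move=> A mA tA mUA; rewrite /mdensity ge0_integral_bigcup//.
- apply: is_cvg_ereal_nneg_natsum_cond => n _ _; exact: mdensity_ge0.
- by apply/measurable_EFinP; exact: measurable_funTS.
- by move=> x _; rewrite lee_fin.
Qed.

HB.instance Definition _ := isMeasure.Build _ _ _ (mdensity mh h0)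
  mdensity0 mdensity_ge0 mdensity_sigma_additive.

End density_measure.

Section independent_normals.
Context {R : realType} {d : measure_display} {Omega : measurableType d}.
Variables (P : probability Omega R) (xi : nat -> Omega -> R).
Hypothesis iid : iid_std_normal P xi.

Lemma iid_measurable j : measurable_fun setT (xi j).
Proof. by case: iid. Qed.

Let gaussian (f : R -> R) := (\int[normal_prob 0 1]_x (f x)%:E)%E.

Lemma iid_bigcap N (B : nat -> set R) : (forall j, measurable (B j)) ->
  (P (\bigcap_(j in [set j | (j < N)%N]) (xi j @^-1` B j)) =
   \prod_(j < N) normal_prob 0 1 (B j))%E.
Proof.
move=> mB; case: iid => _ [law indep].
have /= := indep (iota 0 N) B (iota_uniq _ _) mB.
rewrite (_ : [set i | i \in iota 0 N] = [set j | (j < N)%N]); last first.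
  by apply/seteqP; split => j /=; rewrite mem_iota.
move=> ->; rewrite -[N in LHS]subn0 -/(index_iota 0 N) big_mkord.
by apply: eq_bigr => j _; rewrite law.
Qed.

Let prod_indicators N (B : nat -> set R) (e : nat -> R) :
  (forall j, measurable (B j)) ->
  (forall j, gaussian \1_(B j) = (e j)%:E) ->
  (\int[P]_w (\prod_(j < N) \1_(B j) (xi j w))%:E = (\prod_(j < N) e j)%:E)%E.
Proof.
move=> mB eB; pose A := \bigcap_(j in [set j | (j < N)%N]) (xi j @^-1` B j).
have mA : measurable A.
  apply: bigcap_measurableType => // j _.
  by rewrite -[X in measurable X]setTI; exact: iid_measurable.
transitivity (\int[P]_w (\1_A w)%:E)%E.
  apply: eq_integral => w _; congr (_%:E).
  rewrite indicE; have [/set_mem wA|/negP wA] := boolP (w \in A).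
    rewrite big1// => j _; rewrite indicE mem_set//.
    exact: (wA j (ltn_ord j)).
  apply/eqP; rewrite prodf_seq_eq0; apply/hasP.
  have [j jN nB] : exists2 j, (j < N)%N & ~ B j (xi j w).
    apply: contrapT => nB; apply: wA; apply/mem_set => j /= jN.
    by apply: contrapT => Bj; apply: nB; exists j.
  exists (Ordinal jN); first exact: mem_index_enum.
  by rewrite /= indicE memNset.
rewrite integral_indic// setIT -prodEFin.
rewrite [LHS](iid_bigcap N mB).
by apply: eq_bigr => j _; rewrite -eB /gaussian integral_normal_prob_indic.
Qed.

Lemma ge0_expectation_prod N (f : nat -> R -> R) (e : nat -> R) :
  (forall j, measurable_fun setT (f j)) -> (forall j x, 0 <= f j x) ->
  (forall j, (\int[normal_prob 0 1]_x (f j x)%:E = (e j)%:E)%E) ->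
  (\int[P]_w (\prod_(j < N) f j (xi j w))%:E = (\prod_(j < N) e j)%:E)%E.
Proof.
move=> mf f0 fe.
(* replace the indicators of the product rule by functions, one at a time *)
suff main (m : nat) : forall (f : nat -> R -> R) (e : nat -> R),
    (forall j, measurable_fun setT (f j)) -> (forall j x, 0 <= f j x) ->
    (forall j, gaussian (f j) = (e j)%:E) ->
    (forall j, (m <= j)%N -> exists2 B, measurable B & f j = \1_B) ->
    (\int[P]_w (\prod_(j < N) f j (xi j w))%:E = (\prod_(j < N) e j)%:E)%E.
  (* Slots from [N] on do not occur in the product; they are set to the constant 1, an indicator, so
     that the claim applies with [m] equal to [N]. *)
  pose f' j := if (j < N)%N then f j else \1_setT.
  pose e' j := if (j < N)%N then e j else 1.
  transitivity (\int[P]_w (\prod_(j < N) f' j (xi j w))%:E)%E.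
    apply: eq_integral => w _; congr (_%:E).
    by apply: eq_bigr => j _; rewrite /f' ltn_ord.
  rewrite (main N f' e').
  - by congr (_%:E); apply: eq_bigr => j _; rewrite /e' ltn_ord.
  - by move=> j; rewrite /f'; case: ifPn.
  - by move=> j x; rewrite /f'; case: ifPn => // _; rewrite indicE.
  - move=> j; rewrite /f' /e'; case: ifPn => _; first exact: fe.
    by rewrite /gaussian integral_normal_prob_indic// probability_setT.
  - move=> j; rewrite /f' ltnNge => ->; exists setT => //.
elim: m => {f e mf f0 fe} [|m IH] f e mf f0 fe indf.
  have /choice[B HB] : forall j, exists B, measurable B /\ f j = \1_B.
    by move=> j; have [B mB fB] := indf j (leq0n _); exists B.
  have -> : f = (fun j => \1_(B j)) by apply/funext => j; case: (HB j).
  apply: prod_indicators => j; first by case: (HB j).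
  by rewrite -fe; case: (HB j) => _ ->.
have e0 j : 0 <= e j.
  by rewrite -lee_fin -fe; apply: integral_ge0 => x _; rewrite lee_fin.
have [Nm|mN] := leqP N m.
  pose f' j := if j == m then \1_setT else f j.
  pose e' j := if j == m then 1 else e j.
  have ne (j : 'I_N) : (j == m :> nat) = false.
    by apply/negbTE; rewrite neq_ltn (leq_trans (ltn_ord j)).
  transitivity (\int[P]_w (\prod_(j < N) f' j (xi j w))%:E)%E.
    apply: eq_integral => w _; congr (_%:E).
    by apply: eq_bigr => j _; rewrite /f' ne.
  rewrite (IH f' e').
  - by congr (_%:E); apply: eq_bigr => j _; rewrite /e' ne.
  - by move=> j; rewrite /f'; case: ifPn.
  - by move=> j x; rewrite /f'; case: ifPn => // _; rewrite indicE.
  - move=> j; rewrite /f' /e'; case: ifPn => _; last exact: fe.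
    by rewrite /gaussian integral_normal_prob_indic// probability_setT.
  - move=> j mj; rewrite /f'; case: ifPn => [_|jm]; first by exists setT.
    by apply: indf; rewrite ltn_neqAle eq_sym jm.
pose i := Ordinal mN.
pose h w := \prod_(j < N | j != i) f j (xi j w).
have h0 w : 0 <= h w by apply: prodr_ge0.
have mh : measurable_fun setT h.
  rewrite (_ : h = fun w =>
      \prod_(j < N) (if j != i then f j (xi j w) else 1)); last first.
    by apply/funext => w; rewrite /h big_mkcond.
  apply: measurable_prod => j _; case: (j != i) => //.
  exact: measurableT_comp (iid_measurable j).
have c0 : 0 <= \prod_(j < N | j != i) e j by apply: prodr_ge0.
(* With the other factors frozen in [h], the induction hypothesis for an indicator in slot [m] says
   that under the density [h] the variable [xi m] has a multiple of the standard normal law.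
   Integrating [f m] against this law fills slot [m] with a general function. *)
pose nu := mscale (NngNum c0) (@normal_prob R 0 1).
have nuE B : measurable B ->
    (nu B = \int[P]_(w in xi m @^-1` B) (h w)%:E)%E.
  move=> mB.
  pose f' j := if j == m then \1_B else f j.
  pose e' j := if j == m then fine (normal_prob 0 1 B) else e j.
  have := IH f' e'; rewrite (bigD1 i)//= => IHf.
  transitivity ((\prod_(j < N | j != i) e j)%:E * normal_prob 0 1 B)%E => //.
  rewrite -(@fineK _ (normal_prob 0 1 B)) ?fin_num_measure// -EFinM mulrC.
  transitivity (\int[P]_w (\prod_(j < N) f' j (xi j w))%:E)%E.
    rewrite IHf.
    - congr (_%:E); rewrite {1}/e' eqxx; congr (_ * _).
      by apply: eq_bigr => j; rewrite /e' -val_eqE/= => /negbTE ->.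
    - by move=> j; rewrite /f'; case: ifPn.
    - by move=> j x; rewrite /f'; case: ifPn => // _; rewrite indicE.
    - move=> j; rewrite /f' /e'; case: ifPn => _; last exact: fe.
      by rewrite /gaussian integral_normal_prob_indic// fineK// fin_num_measure.
    - move=> j mj; rewrite /f'; case: ifPn => [_|jm]; first by exists B.
      by apply: indf; rewrite ltn_neqAle eq_sym jm.
  rewrite [RHS]integral_mkcond; apply: eq_integral => w _.
  rewrite patchE (bigD1 i)//= {1}/f' eqxx indicE.
  rewrite -[w \in _]/(xi m w \in B).
  have -> : \prod_(j < N | j != i) f' j (xi j w) = h w.
    by apply: eq_bigr => j; rewrite /f' -val_eqE/= => /negbTE ->.
  by case: ifPn; rewrite ?mul1r ?mul0r.
have H := @ge0_integral_density _ _ Omega (measurableTypeR R) R P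
  (mscale (NngNum c0) (normal_prob 0 1)) (xi m) h (iid_measurable m) mh h0 nuE
  (fun x => (f m x)%:E).
transitivity (\int[P]_w ((f m (xi m w))%:E * (h w)%:E))%E.
  by apply: eq_integral => w _; rewrite (bigD1 i).
rewrite -H; last 2 first.
- by apply/measurable_EFinP; exact: mf.
- by move=> x; rewrite lee_fin.
rewrite [in RHS](bigD1 i)//= ge0_integral_mscale//; last 2 first.
- by apply/measurable_EFinP; exact: mf.
- by move=> x _; rewrite lee_fin.
by rewrite EFinM muleC -fe.
Qed.

End independent_normals.

(** * Dilating finitely many coordinates of the noise *)

Section sequence_space.
Context {R : realType}.

Definition cylinder : set (set (nat -> R)) := [set E | exists N (B : nat -> set R),
  [/\ forall j, measurable (B j), forall j, (N <= j)%N -> B j = setT &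
      E = [set x | forall j, B j (x j)]]].

Lemma cylinder_setI : setI_closed cylinder.
Proof.
move=> _ _ [N [B [mB BT ->]]] [N' [B' [mB' BT' ->]]].
exists (maxn N N'), (fun j => B j `&` B' j); split.
- by move=> j; exact: measurableI.
- by move=> j; rewrite geq_max => /andP[Nj Nj']; rewrite BT// BT'// setIT.
- by apply/seteqP; split => x /= => [[Bx B'x] j|BBx];
    [split; [exact: Bx|exact: B'x]|split => j; case: (BBx j)].
Qed.

(** Laws of the whole noise sequence live here. Cylinders are stable under intersection, so finite
    measures that agree on them coincide. *)
Definition seqspace := g_sigma_algebraType cylinder.

Lemma measurable_coordinate j :
  measurable_fun setT ((fun x => x j) : seqspace -> R).
Proof.
move=> _ B mB; rewrite setTI; apply: sub_sigma_algebra.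
exists j.+1, (fun i => if i == j then B else setT); split.
- by move=> i; case: ifPn.
- by move=> i ji; rewrite gtn_eqF.
- apply/seteqP; split => x /= => [Bx i|/(_ j)]; last by rewrite eqxx.
  by case: eqP => // ->.
Qed.

Lemma measurable_seqspace d (T : measurableType d) (f : T -> nat -> R) :
  (forall j, measurable_fun setT (fun w => f w j)) ->
  measurable_fun setT (f : T -> seqspace).
Proof.
move=> mf; apply: (@measurability _ _ T seqspace _ _ cylinder) => //.
move=> _ [_ [N [B [mB _ ->]]] <-].
rewrite (_ : _ `&` _ = \bigcap_j ((fun w => f w j) @^-1` B j)); last first.
  by apply/seteqP; split => w /= => [[_ Bw] j _|Bw]; [exact: Bw|split => // j; exact: Bw].
apply: bigcapT_measurable => j.
by rewrite -[X in measurable X]setTI; exact: mf.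
Qed.

End sequence_space.

Section scaling.
Context {R : realType} {d : measure_display} {Omega : measurableType d}.
Variables (P : probability Omega R) (xi : nat -> Omega -> R).
Hypothesis iid : iid_std_normal P xi.
Variables (N : nat) (c : nat -> R).
Hypothesis c_gt0 : forall j, 0 < c j.
Hypothesis c_eq1 : forall j, (N <= j)%N -> c j = 1.

Let L (w : Omega) := \prod_(j < N) scale_density (c j) (xi j w).

Let L0 w : 0 <= L w.
Proof. by apply: prodr_ge0 => j _; exact: scale_density_ge0. Qed.

Let mL : measurable_fun setT L.
Proof.
apply: measurable_prod => j _.
exact: measurableT_comp (measurable_scale_density _) (iid_measurable iid j).
Qed.

Let mX : measurable_fun setT ((fun w j => xi j w) : Omega -> @seqspace R).
Proof. by apply: measurable_seqspace => j; exact: (iid_measurable iid j). Qed.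

Let mcX : measurable_fun setT ((fun w j => c j * xi j w) : Omega -> @seqspace R).
Proof.
by apply: measurable_seqspace => j; apply: measurable_funM => //;
  exact: (iid_measurable iid j).
Qed.

(** On a cylinder both sides factor by independence, and the factors agree by [normal_prob_scale].
    Coordinates from [M] on are neither constrained nor dilated. *)
Let scaling_cylinder E : cylinder E ->
  (P [set w | E (fun j => (c j * xi j w)%R)] =
   \int[P]_(w in [set w | E (fun j => xi j w)]) (L w)%:E)%E.
Proof.
move=> [N' [B [mB BT ->]]]; pose M := maxn N N'.
have mcB j : measurable ((fun x : R => c j * x) @^-1` B j).
  rewrite -[X in measurable X]setTI; have : measurable_fun setT (fun x : R => c j * x).
    exact: measurable_funM.
  exact.
have indE (B' : nat -> set R) w : (forall j, (M <= j)%N -> B' j = setT) ->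
    \1_[set w | forall j, B' j (xi j w)] w = \prod_(j < M) \1_(B' j) (xi j w) :> R.
  move=> BT'; rewrite indicE.
  have [/set_mem/= wB|/negP wB] := boolP (w \in _).
    by rewrite big1// => j _; rewrite indicE mem_set.
  apply/esym/eqP; rewrite prodf_seq_eq0; apply/hasP.
  have [j nB] : exists j, ~ B' j (xi j w).
    apply: contrapT => nB; apply: wB; apply/mem_set => j /=.
    by apply: contrapT => Bj; apply: nB; exists j.
  have jM : (j < M)%N by rewrite ltnNge; apply/negP => /BT' BjT; apply: nB; rewrite BjT.
  exists (Ordinal jM); first exact: mem_index_enum.
  by rewrite /= indicE memNset.
pose e j := fine (normal_prob 0 1 ((fun x : R => c j * x) @^-1` B j)).
have eE j : (e j)%:E = normal_prob 0 1 ((fun x : R => c j * x) @^-1` B j).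
  by rewrite fineK//; apply: fin_num_measure; exact: mcB.
transitivity ((\prod_(j < M) e j)%:E).
  rewrite -(@ge0_expectation_prod _ _ _ P xi iid M
    (fun j => \1_((fun x : R => c j * x) @^-1` B j))); first last.
  - by move=> j; rewrite eE integral_normal_prob_indic.
  - by move=> j x; rewrite indicE.
  - by move=> j; exact: measurable_indic.
  have mE : measurable [set w | forall j, ((fun x : R => c j * x) @^-1` B j) (xi j w)].
    have -> : [set w | forall j, ((fun x : R => c j * x) @^-1` B j) (xi j w)] =
        \bigcap_j (xi j @^-1` ((fun x : R => c j * x) @^-1` B j)).
      by apply/seteqP; split => w /= => [Bw j _|Bw j]; exact: Bw.
    apply: bigcapT_measurable => j; rewrite -[X in measurable X]setTI.
    exact: (iid_measurable iid j).
  under eq_integral => w _.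
    rewrite -(indE (fun j => (fun x : R => c j * x) @^-1` B j)); last first.
      move=> j; rewrite /M geq_max => /andP[_ /BT ->]; exact: preimage_setT.
    over.
  by rewrite integral_indic// setIT.
rewrite [RHS]integral_mkcond.
rewrite -(@ge0_expectation_prod _ _ _ P xi iid M
  (fun j x => scale_density (c j) x * \1_(B j) x)); first last.
- by move=> j; rewrite eE normal_prob_scale.
- by move=> j x; rewrite mulr_ge0 ?scale_density_ge0// indicE.
- by move=> j; apply: measurable_funM => //; exact: measurable_scale_density.
apply: eq_integral => w _; rewrite big_split/= -indE; last first.
  by move=> j; rewrite /M geq_max => /andP[_ /BT].
have -> : \prod_(j < M) scale_density (c j) (xi j w) = L w.
  rewrite -!(big_mkord predT (fun j => scale_density (c j) (xi j w))).
  rewrite (big_cat_nat (n := N))//= ?leq_maxl// [X in _ * X]big1_seq ?mulr1 ?big_mkord//.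
  move=> j /andP[_]; rewrite mem_index_iota => /andP[Nj _].
  by rewrite c_eq1// scale_density1.
by rewrite patchE indicE; case: ifPn; rewrite ?mulr1 ?mulr0.
Qed.

(** The law of the dilated noise and the law of the noise reweighted by the product of likelihood
    ratios agree on the pi-system of cylinders, hence everywhere. *)
Lemma scaling_density (E : set (@seqspace R)) : measurable E ->
  (P [set w | E (fun j => (c j * xi j w)%R)] =
   \int[P]_(w in [set w | E (fun j => xi j w)])
     (\prod_(j < N) scale_density (c j) (xi j w))%:E)%E.
Proof.
move=> mE.
pose m1 : {measure set (@seqspace R) -> \bar R} :=
  pushforward P ((fun w j => c j * xi j w) : Omega -> @seqspace R).
pose m2 : {measure set (@seqspace R) -> \bar R} :=
  pushforward (mdensity P mL L0) ((fun w j => xi j w) : Omega -> @seqspace R).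
have -> : P [set w | E (fun j => (c j * xi j w)%R)] = m1 mcX E by [].
have -> : (\int[P]_(w in [set w | E (fun j => xi j w)])
     (\prod_(j < N) scale_density (c j) (xi j w))%:E)%E = m2 mX E by [].
apply: (@measure_unique _ _ (@seqspace R) cylinder (fun=> setT)) => //.
- exact: cylinder_setI.
- move=> _; exists 0%N, (fun=> setT); split => //.
  by apply/seteqP; split.
- by apply/seteqP; split => // x _; exists 0%N.
- by move=> _; rewrite -[X in (X < _)%E]/(P setT) probability_setT ltry.
Qed.

(* Q(E) = E[L; E] and L <= l + L^2/l *)
Lemma scaling_compare (E : set (@seqspace R)) (l : R) : measurable E -> 0 < l ->
  (P [set w | E (fun j => (c j * xi j w)%R)] <=
   l%:E * P [set w | E (fun j => xi j w)] +
   (l^-1)%:E * \int[P]_w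
     (\prod_(j < N) (scale_density (c j) (xi j w) ^+ 2))%:E)%E.
Proof.
move=> mE l0; rewrite scaling_density//.
rewrite -[X in (X <= _)%E]/(\int[P]_(w in [set w | E (fun j => xi j w)]) (L w)%:E)%E.
have mEX : measurable [set w | E (fun j => xi j w)].
  by rewrite -[X in measurable X]setTI; exact: mX.
have mL2 : measurable_fun setT (fun w => (L w ^+ 2)%:E).
  by apply/measurable_EFinP; exact: measurable_funX.
have -> : (\int[P]_w (\prod_(j < N) (scale_density (c j) (xi j w) ^+ 2))%:E =
    \int[P]_w (L w ^+ 2)%:E)%E.
  by apply: eq_integral => w _; rewrite /L prodrXl.
rewrite -(integral_cst P mEX) -ge0_integralZl_EFin//; last 2 first.
- by move=> w _; rewrite lee_fin sqr_ge0.
- by rewrite invr_ge0 ltW.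
apply: (@le_trans _ _ (\int[P]_(w in [set w | E (fun j => xi j w)])
  (l%:E + (l^-1)%:E * (L w ^+ 2)%:E)))%E.
  apply: ge0_le_integral => //.
  - by move=> w _; rewrite lee_fin.
  - by apply/measurable_EFinP; exact: measurable_funTS.
  - apply: emeasurable_funD => //; apply: measurable_funTS.
    exact: emeasurable_funM.
  - move=> w _; rewrite -EFinM -EFinD lee_fin.
    have [Ll|lL] := leP (L w) l.
      by rewrite (le_trans Ll)// lerDl mulr_ge0 ?sqr_ge0// invr_ge0 ltW.
    apply: (@le_trans _ _ (l^-1 * L w ^+ 2)); last by rewrite lerDr ltW.
    by rewrite ler_pdivlMl// expr2 ler_wpM2r// ltW.
rewrite ge0_integralD//; last 3 first.
- by move=> w _; rewrite lee_fin ltW.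
- by move=> w _; rewrite -EFinM lee_fin mulr_ge0 ?sqr_ge0 ?invr_ge0// ltW.
- by apply: measurable_funTS; exact: emeasurable_funM.
rewrite leeD2l//; apply: ge0_subset_integral => //.
- exact: emeasurable_funM.
- by move=> w _; rewrite -EFinM lee_fin mulr_ge0 ?sqr_ge0 ?invr_ge0// ltW.
Qed.

End scaling.

(** * Real-valued probabilities and exponential tail bounds *)

Section real_probability.
Context {R : realType} {d : measure_display} {Omega : measurableType d}.
Variable P : probability Omega R.
Implicit Types (A B C : set Omega) (F : Omega -> R).
Local Notation pr A := (fine (P A)).

Lemma pr_ge0 A : 0 <= pr A.
Proof. exact/fine_ge0/measure_ge0. Qed.

Lemma pr_EFin A : measurable A -> (pr A)%:E = P A.
Proof. by move=> mA; rewrite fineK// fin_num_measure. Qed.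

Lemma pr_le A B : measurable A -> measurable B -> A `<=` B -> pr A <= pr B.
Proof. by move=> mA mB AB; rewrite -lee_fin !pr_EFin// le_measure ?inE. Qed.

Lemma pr_le1 A : measurable A -> pr A <= 1.
Proof. by move=> mA; rewrite -lee_fin pr_EFin// probability_le1. Qed.

Lemma pr_leU A B C : measurable A -> measurable B -> measurable C ->
  A `<=` B `|` C -> pr A <= pr B + pr C.
Proof.
move=> mA mB mC ABC; rewrite -lee_fin EFinD !pr_EFin//.
apply: le_trans (measureU2 _ mB mC); rewrite le_measure ?inE//.
exact: measurableU.
Qed.

Lemma pr_geU A B C : measurable A -> measurable B -> measurable C ->
  B `|` C `<=` A -> B `&` C = set0 -> pr B + pr C <= pr A.
Proof.
move=> mA mB mC BCA BC0; rewrite -lee_fin EFinD !pr_EFin//.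
rewrite -measureU//.
by rewrite le_measure ?inE//; exact: measurableU.
Qed.

Lemma pr_setC A : measurable A -> pr (~` A) = 1 - pr A.
Proof.
move=> mA; apply: EFin_inj; rewrite EFinB !pr_EFin//; last exact: measurableC.
by rewrite probability_setC.
Qed.

Lemma pr_le_bigU n A (B : nat -> set Omega) : measurable A ->
  (forall i, measurable (B i)) ->
  A `<=` [set w | exists2 i, (i < n)%N & B i w] ->
  pr A <= \sum_(i < n) pr (B i).
Proof.
move=> mA mB; elim: n A mA => [|n IH] A mA AB.
  rewrite big_ord0 (_ : A = set0) ?measure0//.
  by apply/seteqP; split => // w /AB[].
pose A' := A `\` B n; have mA' : measurable A' by exact: measurableD.
rewrite big_ord_recr/=; apply: (@le_trans _ _ (pr A' + pr (B n))).
  by apply: pr_leU => // w Aw; have [Bn|Bn] := pselect (B n w); [right|left].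
rewrite lerD2r; apply: IH => // w [/AB[i]]; rewrite ltnS leq_eqVlt.
by case/predU1P => [->//|ni Bi _]; exists i.
Qed.

Lemma pr_sum_disjoint_le1 n (B : nat -> set Omega) :
  (forall i, measurable (B i)) -> (forall i j w, B i w -> B j w -> i = j) ->
  \sum_(i < n) pr (B i) <= 1.
Proof.
move=> mB dB; pose A n := [set w | exists2 i, (i < n)%N & B i w].
have mA m : measurable (A m).
  rewrite (_ : A m = \bigcup_(i in [set i | (i < m)%N]) B i).
    by apply: bigcup_measurable => *; exact: mB.
  by apply/seteqP; split => w /= [i im Bi]; exists i.
apply: le_trans (pr_le1 (mA n)); elim: n => [|n IH].
  by rewrite big_ord0 pr_ge0.
rewrite big_ord_recr/=; apply: (@le_trans _ _ (pr (A n) + pr (B n))).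
  by rewrite lerD2r.
apply: pr_geU => //.
  move=> w [[i im Bi]|Bn]; last by exists n.
  by exists i => //; rewrite ltnS ltnW.
apply/seteqP; split => // w [[i im Bi] Bn].
by move: im; rewrite (dB _ _ _ Bi Bn) ltnn.
Qed.

Lemma measurable_event F (B : set R) : measurable_fun setT F ->
  measurable B -> measurable [set w | B (F w)].
Proof. by move=> mF mB; rewrite -[X in measurable X]setTI; exact: mF. Qed.

Lemma measurable_event_ge F (t : R) : measurable_fun setT F ->
  measurable [set w | t <= F w].
Proof.
move=> mF; rewrite (_ : [set w | _] = [set w | `[t, +oo[%classic (F w)]).
  exact: measurable_event.
by apply/seteqP; split => w /=; rewrite in_itv/= andbT.
Qed.

Lemma measurable_event_le F (t : R) : measurable_fun setT F ->
  measurable [set w | F w <= t].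
Proof.
move=> mF; rewrite (_ : [set w | _] = [set w | `]-oo, t]%classic (F w)]).
  exact: measurable_event.
by apply/seteqP; split => w /=; rewrite in_itv/=.
Qed.

Lemma measurable_event_gt F (t : R) : measurable_fun setT F ->
  measurable [set w | t < F w].
Proof.
move=> mF; rewrite (_ : [set w | _] = ~` [set w | F w <= t]).
  exact/measurableC/measurable_event_le.
by apply/seteqP; split => w /=; rewrite ltNge => /negP.
Qed.

Lemma measurable_event_itv F (s t : R) : measurable_fun setT F ->
  measurable [set w | s <= F w <= t].
Proof.
move=> mF; rewrite (_ : [set w | _] = [set w | `[s, t]%classic (F w)]).
  exact: measurable_event.
by apply/seteqP; split => w /=; rewrite in_itv.
Qed.

End real_probability.

Section chernoff.
Context {R : realType} {d : measure_display} {Omega : measurableType d}.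
Variables (P : probability Omega R) (xi : nat -> Omega -> R).
Hypothesis iid : iid_std_normal P xi.
Local Notation pr A := (fine (P A)).

Lemma big_nat1_ord (F : nat -> R) N :
  \sum_(1 <= j < N) F j = \sum_(j < N) (if j == 0%N :> nat then 0 else F j).
Proof.
case: N => [|N]; first by rewrite big_ord0 big_geq.
rewrite big_ord_recl/= add0r big_add1/= big_mkord.
by apply: eq_bigr.
Qed.

Lemma measurable_sum_nat m N (F : nat -> Omega -> R) :
  (forall j, measurable_fun setT (F j)) ->
  measurable_fun setT (fun w => \sum_(m <= j < N) F j w).
Proof. by move=> mF; apply: measurable_sum. Qed.

(** Markov's inequality for the exponential of the sum, whose expectation factors by
    independence. *)
Lemma chernoff N (g : nat -> R -> R) (b : nat -> R) (x : R) :
  (forall j, measurable_fun setT (g j)) ->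
  (forall j, (0 < j)%N ->
    (\int[normal_prob 0 1]_y (expR (g j y))%:E <= (expR (b j))%:E)%E) ->
  pr [set w | x <= \sum_(1 <= j < N) g j (xi j w)] <=
  expR (- x + \sum_(1 <= j < N) b j).
Proof.
move=> mg gb; set Y := fun w => \sum_(1 <= j < N) g j (xi j w).
have mY : measurable_fun setT Y.
  apply: measurable_sum_nat => j.
  exact: measurableT_comp (mg j) (iid_measurable iid j).
have mE : measurable [set w | x <= Y w] by exact: measurable_event_ge.
(* Index 0 gets the factor 1, so that the product over all [j < N] matches a sum that starts at
   1. *)
pose f j y := if j == 0%N then 1 else expR (g j y).
pose e j := fine (\int[normal_prob 0 1]_y (f j y)%:E)%E.
have f0 j y : 0 <= f j y by rewrite /f; case: ifP; rewrite ?expR_ge0.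
have fb j : (\int[normal_prob 0 1]_y (f j y)%:E <=
    (expR (if j == 0%N then 0 else b j))%:E)%E.
  rewrite /f; case: (posnP j) => [_|]; last exact: gb.
  have -> : (\int[normal_prob 0 1]_(y in [set: measurableTypeR R]) (1 : R)%:E =
      \int[normal_prob 0 1]_y (\1_(setT : set R) y)%:E)%E.
    by apply: eq_integral => y _; rewrite indicT.
  by rewrite expR0 integral_normal_prob_indic// probability_setT.
have int0 j : (0 <= \int[normal_prob 0 1]_y (f j y)%:E)%E.
  by apply: integral_ge0 => y _; rewrite lee_fin.
have fe j : (\int[normal_prob 0 1]_y (f j y)%:E = (e j)%:E)%E.
  by rewrite fineK// ge0_fin_numE// (le_lt_trans (fb j)) ?ltry.
have EY : (\int[P]_w (expR (Y w))%:E <= (expR (\sum_(1 <= j < N) b j))%:E)%E.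
  have -> : (\int[P]_w (expR (Y w))%:E =
      \int[P]_w (\prod_(j < N) f j (xi j w))%:E)%E.
    apply: eq_integral => w _; congr (_%:E).
    rewrite /Y big_nat1_ord expR_sum; apply: eq_bigr => j _.
    by rewrite /f; case: ifPn; rewrite ?expR0.
  rewrite (ge0_expectation_prod iid _ _ f0 fe); last first.
    move=> j; rewrite /f; case: (j == 0%N) => //.
    exact: measurableT_comp (mg j).
  rewrite lee_fin big_nat1_ord expR_sum; apply: ler_prod => j _.
  rewrite -!lee_fin -fe int0/=; exact: fb.
have : (\int[P]_(w in [set w | (x <= Y w)%R]) (expR x)%:E <=
    \int[P]_w (expR (Y w))%:E)%E.
  apply: (@le_trans _ _ (\int[P]_(w in [set w | (x <= Y w)%R]) (expR (Y w))%:E)%E).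
    apply: ge0_le_integral => //.
    - by apply: measurable_funTS; apply/measurable_EFinP; exact: measurableT_comp.
    - by move=> w /= xY; rewrite lee_fin ler_expR.
  apply: ge0_subset_integral => //.
  by apply/measurable_EFinP; exact: measurableT_comp.
move=> /le_trans /(_ EY).
rewrite [X in (X <= _)%E -> _](integral_cst P mE (expR x)%:E).
rewrite -[X in (_ * X <= _)%E -> _](pr_EFin P mE) -EFinM lee_fin.
by rewrite expRD expRN ler_pdivlMl ?expR_gt0.
Qed.

(** The Laplace transform of [y * (xi^2 - 1)] is exp(-y) / sqrt(1 - 2y), which is at most exp(4 y^2)
    when |y| is at most 1/4. *)
Lemma quad_tail N (y : nat -> R) (x : R) : (forall j, (0 < j)%N -> `|y j| <= 4^-1) ->
  pr [set w | x <= \sum_(1 <= j < N) y j * (xi j w ^+ 2 - 1)] <=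
  expR (- x + 4 * \sum_(1 <= j < N) y j ^+ 2).
Proof.
move=> y4; rewrite mulr_sumr.
apply: (@chernoff N (fun j t => y j * (t ^+ 2 - 1)) (fun j => 4 * y j ^+ 2)).
  move=> j; apply: measurable_funM => //; apply: measurable_funB => //.
move=> j j0; have := y4 j j0; rewrite ler_norml => /andP[yl yr].
have -> : (\int[normal_prob 0 1]_t (expR (y j * (t ^+ 2 - 1)))%:E =
    \int[normal_prob 0 1]_t ((expR (- y j))%:E * (expR (y j * t ^+ 2))%:E))%E.
  apply: eq_integral => t _; rewrite -EFinM -expRD; congr (expR _)%:E.
  by rewrite mulrBr mulr1 addrC.
rewrite ge0_integralZl_EFin//; last first.
  by apply/measurable_EFinP; apply: measurableT_comp => //; apply: measurable_funM.
rewrite normal_laplace_sqr; last by lra.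
have d0 : 0 < 1 - 2 * y j by lra.
rewrite -EFinM lee_fin expRN ler_pdivrMl ?expR_gt0// -expRD.
rewrite -[leRHS]mul1r -ler_pdivrMr ?expR_gt0// mulrC ler_pdivrMl ?expR_gt0//.
rewrite mulr1 -[leLHS]ger0_norm ?invr_ge0 ?sqrtr_ge0//.
rewrite -[leRHS]ger0_norm ?expR_ge0// -ler_sqr ?nnegrE//.
rewrite !real_normK ?num_real// exprVn sqr_sqrtr ?(ltW d0)//.
rewrite -expRM_natl -[leLHS]mul1r ler_pdivrMr//.
(* After squaring, it remains to bound 1 by exp(2y + 8y^2)(1 - 2y). Since exp(x) is at least 1 + x,
   it suffices that (1 + 2y + 8y^2)(1 - 2y) = 1 + 4y^2(1 - 4y) is at least 1. *)
apply: le_trans (_ : (1 + 2 * (y j + 4 * y j ^+ 2)) * (1 - 2 * y j) <= _).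
  have : 0 <= y j ^+ 2 * (1 - 4 * y j) by rewrite mulr_ge0 ?sqr_ge0//; lra.
  nra.
by rewrite ler_wpM2r ?(ltW d0)// expR_ge1Dx.
Qed.

Lemma quad_abs_tail N (y : nat -> R) (x : R) : (forall j, (0 < j)%N -> `|y j| <= 4^-1) ->
  pr [set w | x <= `|\sum_(1 <= j < N) y j * (xi j w ^+ 2 - 1)|] <=
  2 * expR (- x + 4 * \sum_(1 <= j < N) y j ^+ 2).
Proof.
move=> y4; rewrite mulr_natl mulr2n.
have mq (z : nat -> R) :
    measurable_fun setT (fun w => \sum_(1 <= j < N) z j * (xi j w ^+ 2 - 1)).
  apply: measurable_sum_nat => j; apply: measurable_funM => //.
  apply: measurable_funB => //; apply: measurable_funX.
  exact: (iid_measurable iid j).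
have sqN : \sum_(1 <= j < N) y j ^+ 2 = \sum_(1 <= j < N) (- y j) ^+ 2.
  by apply: eq_bigr => j _; rewrite sqrrN.
apply: le_trans (lerD (quad_tail N x y4) _); last first.
  rewrite {1}sqN; apply: (@quad_tail N (fun j => - y j) x) => j j0.
  by rewrite normrN y4.
apply: pr_leU.
- by apply: measurable_event_ge; exact: measurableT_comp.
- exact: measurable_event_ge.
- exact: measurable_event_ge.
move=> w /=; rewrite ler_normr -sumrN => /orP[|xw]; [by left|right].
by under eq_bigr do rewrite mulNr.
Qed.

Lemma lin_tail N (b : nat -> R) (x : R) :
  pr [set w | x <= \sum_(1 <= j < N) b j * xi j w] <=
  expR (- x + \sum_(1 <= j < N) b j ^+ 2 / 2).
Proof.
apply: (@chernoff N (fun j t => b j * t) (fun j => b j ^+ 2 / 2)).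
  by move=> j; apply: measurable_funM.
by move=> j _; rewrite normal_laplace.
Qed.

End chernoff.

(** * Dilations of the leading coordinates *)

Section scaling_cost.
Context {R : realType} {d : measure_display} {Omega : measurableType d}.
Variables (P : probability Omega R) (xi : nat -> Omega -> R).
Hypothesis iid : iid_std_normal P xi.
Local Notation pr A := (fine (P A)).

(** The factor is chosen on the variance scale: the first [K] coordinates get variance [1 + e],
    which makes the change of a quadratic form linear in [e]. *)
Definition head_scale (K : nat) (e : R) (j : nat) : R :=
  if (0 < j <= K)%N then Num.sqrt (1 + e) else 1.

(** The second moment of the likelihood ratio equals (1 - e^2)^(-1/2). Its square is at most exp(2
    e^2), because (1 + 2t)(1 - t) is at least 1 for t between 0 and 1/2. *)
Lemma scale_density_chi2 (e : R) : e ^+ 2 <= 2^-1 ->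
  (\int[normal_prob 0 1]_x (scale_density (Num.sqrt (1 + e)) x ^+ 2)%:E
   <= (expR (e ^+ 2))%:E)%E.
Proof.
move=> e2; have [el eu] : -1 < e /\ e < 1 by split; nra.
set v := 1 + e; have v0 : 0 < v by rewrite /v; lra.
have u2 : 1 - v^-1 < 2^-1.
  have : 2^-1 < v^-1 by rewrite ltf_pV2 ?posrE// /v; lra.
  by lra.
have dE : 1 - 2 * (1 - v^-1) = (2 - v) / v by field; rewrite gt_eqF.
have -> : (\int[normal_prob 0 1]_x (scale_density (Num.sqrt v) x ^+ 2)%:E =
    \int[normal_prob 0 1]_x (v^-1%:E * (expR ((1 - v^-1) * x ^+ 2))%:E))%E.
  apply: eq_integral => x _; rewrite -EFinM /scale_density; congr (_%:E).
  rewrite exprMn exprVn sqr_sqrtr ?(ltW v0)// -expRM_natl; congr (_ * expR _).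
  by rewrite (mulrA 2) (mulrC 2) divfK ?pnatr_eq0.
rewrite ge0_integralZl_EFin//; last 2 first.
- by apply/measurable_EFinP; apply: measurableT_comp => //; apply: measurable_funM.
- by rewrite invr_ge0 ltW.
rewrite normal_laplace_sqr// -EFinM lee_fin dE.
have d0 : 0 < (2 - v) / v by rewrite divr_gt0// /v; lra.
have p0 : 0 <= v^-1 / Num.sqrt ((2 - v) / v).
  by rewrite mulr_ge0 ?invr_ge0 ?sqrtr_ge0// ltW.
rewrite -ler_sqr ?nnegrE ?expR_ge0// exprMn exprVn [X in _ * X]exprVn.
rewrite sqr_sqrtr ?(ltW d0)// -expRM_natl.
have -> : v ^- 2 * ((2 - v) / v)^-1 = (1 - e ^+ 2)^-1.
  have v1 : 1 + e != 0 by rewrite gt_eqF.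
  have v2 : 1 - e != 0 by apply/eqP; lra.
  rewrite /v (_ : 2 - (1 + e) = 1 - e); last by ring.
  by rewrite (_ : 1 - e ^+ 2 = (1 - e) * (1 + e)); [field; rewrite v1 v2|ring].
have e1 : 0 < 1 - e ^+ 2 by lra.
rewrite -[leLHS]mul1r ler_pdivrMr//.
apply: le_trans (_ : (1 + 2 * e ^+ 2) * (1 - e ^+ 2) <= _).
  by have := sqr_ge0 e; nra.
by rewrite ler_wpM2r ?(ltW e1)// expR_ge1Dx.
Qed.

Lemma scale_cost K (e : R) : e ^+ 2 <= 2^-1 ->
  (\int[P]_w (\prod_(j < K.+1)
     (scale_density (head_scale K e j) (xi j w) ^+ 2))%:E
   <= (expR (K%:R * e ^+ 2))%:E)%E.
Proof.
move=> e2.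
pose f j x := scale_density (head_scale K e j) x ^+ 2.
have f0 j x : 0 <= f j x by exact: sqr_ge0.
have fb j : (\int[normal_prob 0 1]_y (f j y)%:E <=
    (expR (if (j == 0)%N then 0 else e ^+ 2))%:E)%E.
  have one : (\int[normal_prob 0 1]_y (scale_density (1 : R) y ^+ 2)%:E = 1)%E.
    transitivity (\int[normal_prob 0 1]_y (\1_(setT : set R) y)%:E)%E.
      by apply: eq_integral => y _; rewrite indicT scale_density1 expr1n.
    by rewrite integral_normal_prob_indic// probability_setT.
  rewrite /f /head_scale; case: ifPn => [/andP[j0 _]|].
    by rewrite gtn_eqF//; exact: scale_density_chi2.
  by move=> _; rewrite one lee_fin -expR0 ler_expR; case: ifP; rewrite ?sqr_ge0.
have int0 j : (0 <= \int[normal_prob 0 1]_y (f j y)%:E)%E.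
  by apply: integral_ge0 => y _; rewrite lee_fin.
pose e' j := fine (\int[normal_prob 0 1]_y (f j y)%:E)%E.
have fe j : (\int[normal_prob 0 1]_y (f j y)%:E = (e' j)%:E)%E.
  by rewrite fineK// ge0_fin_numE// (le_lt_trans (fb j)) ?ltry.
rewrite (ge0_expectation_prod iid _ _ f0 fe); last first.
  by move=> j; apply: measurable_funX; exact: measurable_scale_density.
rewrite lee_fin.
have -> : K%:R * e ^+ 2 = \sum_(j < K.+1) (if j == 0%N :> nat then 0 else e ^+ 2).
  by rewrite big_ord_recl/= add0r sumr_const card_ord mulr_natl.
rewrite expR_sum; apply: ler_prod => j _.
rewrite -!lee_fin -fe int0/=; exact: fb.
Qed.

(** The parameter [l] stays free: a large [l] makes the second term small at the price of a large
    but fixed factor in the first. *)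
Lemma head_scaling_pr K (e l : R) (E : set (@seqspace R)) : e ^+ 2 <= 2^-1 ->
  0 < l -> measurable E ->
  pr [set w | E (fun j => head_scale K e j * xi j w)] <=
  l * pr [set w | E (fun j => xi j w)] + expR (K%:R * e ^+ 2) / l.
Proof.
move=> e2 l0 mE; have e1 : -1 < e by nra.
have c0 j : 0 < head_scale K e j.
  by rewrite /head_scale; case: ifP => // _; rewrite sqrtr_gt0; lra.
have c1 j : (K.+1 <= j)%N -> head_scale K e j = 1.
  by move=> Kj; rewrite /head_scale [(j <= K)%N]leqNgt Kj andbF.
have mX : measurable_fun setT ((fun w j => xi j w) : Omega -> @seqspace R).
  by apply: measurable_seqspace => j; exact: (iid_measurable iid j).
have mcX : measurable_fun setT
    ((fun w j => head_scale K e j * xi j w) : Omega -> @seqspace R).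
  by apply: measurable_seqspace => j; apply: measurable_funM => //;
    exact: (iid_measurable iid j).
have mE1 : measurable [set w | E (fun j => xi j w)].
  by rewrite -[X in measurable X]setTI; exact: mX.
have mE2 : measurable [set w | E (fun j => head_scale K e j * xi j w)].
  by rewrite -[X in measurable X]setTI; exact: mcX.
rewrite -lee_fin EFinD EFinM !pr_EFin//.
apply: le_trans (scaling_compare iid c0 c1 mE l0) _.
rewrite leeD2l// mulrC EFinM lee_wpmul2l ?lee_fin ?invr_ge0 ?(ltW l0)//.
exact: scale_cost.
Qed.

End scaling_cost.

Section quadratic_form.
Context {R : realType} {d : measure_display} {Omega : measurableType d}.
Variables (P : probability Omega R) (xi : nat -> Omega -> R).
Hypothesis iid : iid_std_normal P xi.
Local Notation pr A := (fine (P A)).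

Definition quad (a : nat -> R) (N : nat) (x : nat -> R) :=
  \sum_(1 <= j < N) a j * (x j ^+ 2 - 1).

Definition head_sum (a : nat -> R) (K : nat) : R := \sum_(1 <= j < K.+1) a j.

(** What the estimates need uniformly in the form: the bounds 1/4 and [V] feed the exponential tail
    bounds, [K < N] puts the dilated coordinates inside the truncated form, and the last bound keeps
    the cost of the dilation by s / [head_sum a K] below exp(D s^2). *)
Definition admissible (V D : R) (a : nat -> R) (K N : nat) :=
  [/\ forall j, (0 < j)%N -> 0 <= a j <= 4^-1, \sum_(1 <= j < N) a j ^+ 2 <= V,
      (K < N)%N & K%:R <= D * head_sum a K ^+ 2].

Local Notation U a N := (fun w => quad a N (fun j => xi j w)).

Lemma measurable_quad a N : measurable_fun setT (U a N).
Proof.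
apply: measurable_sum_nat => j; apply: measurable_funM => //.
by apply: measurable_funB => //; apply: measurable_funX; exact: (iid_measurable iid j).
Qed.

Lemma measurable_quad_seqspace a N :
  measurable_fun setT (quad a N : @seqspace R -> R).
Proof.
apply: measurable_sum => j; apply: measurable_funM => //.
by apply: measurable_funB => //; apply: measurable_funX; exact: measurable_coordinate.
Qed.

Lemma quad_head_scale a K N e (x : nat -> R) : (K < N)%N -> -1 < e ->
  quad a N (fun j => head_scale K e j * x j) =
  quad a N x + e * (quad a K.+1 x + head_sum a K).
Proof.
move=> KN e1; rewrite /quad /head_sum -big_split/= mulr_sumr.
rewrite (big_cat_nat (n := K.+1) (p := N))//=.
rewrite [in RHS](big_cat_nat (n := K.+1) (p := N))//= [in RHS]addrAC -big_split/=.
congr (_ + _); apply: eq_big_nat => j /andP[j1 j2].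
  rewrite /head_scale j1 -ltnS j2/= exprMn sqr_sqrtr; last by lra.
  ring.
by rewrite /head_scale [(j <= K)%N]leqNgt j1 andbF mul1r.
Qed.

Lemma sum_sqr_head (a : nat -> R) K N : (K < N)%N ->
  \sum_(1 <= j < K.+1) a j ^+ 2 <= \sum_(1 <= j < N) a j ^+ 2.
Proof.
move=> KN; rewrite [leRHS](big_cat_nat (n := K.+1))//= lerDl.
by apply: sumr_ge0 => j _; exact: sqr_ge0.
Qed.

(* The dilation adds e * sum_(j <= K) a_j xi_j^2 to the form, which is close to the
   constant s when e = s / head_sum a K. *)
Lemma transport V D a K N (s s1 h l y : R) : admissible V D a K N ->
  0 < l -> 0 < h -> 0 < s1 -> `|s| <= s1 -> 2 * s1 <= head_sum a K ->
  pr [set w | y <= U a N w <= y + h] <=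
  l * pr [set w | y + s - h <= U a N w <= y + s + 2 * h] +
  expR (D * s1 ^+ 2) / l + 2 * expR (- (h * head_sum a K / s1) + 4 * V).
Proof.
move=> [a4 aV KN KD] l0 h0 s10 ss1 s1A; set A := head_sum a K in KD s1A *.
have A0 : 0 < A by lra.
pose e := s / A.
have es : e * A = s by rewrite /e divfK// gt_eqF.
have eA : `|e| * A = `|s| by rewrite -[in RHS]es [RHS]normrM (gtr0_norm A0).
have e_half : `|e| <= 2^-1.
  by rewrite -(ler_pM2r A0) eA; lra.
have e2 : e ^+ 2 <= 2^-1.
  rewrite -real_normK ?num_real//; have := normr_ge0 e; nra.
have e1 : -1 < e by move: e_half; rewrite ler_norml => /andP[]; lra.
have costE : K%:R * e ^+ 2 <= D * s1 ^+ 2.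
  have D0 : 0 <= D.
    have := le_trans (ler0n R K) KD.
    by rewrite pmulr_lge0// exprn_gt0.
  apply: (@le_trans _ _ (D * A ^+ 2 * e ^+ 2)).
    by rewrite ler_wpM2r// sqr_ge0.
  rewrite -mulrA -exprMn mulrC [A * e]mulrC es mulrC ler_wpM2l//.
  by rewrite -(real_normK (num_real s)) ler_sqr ?nnegrE// ltW.
pose E : set (@seqspace R) := [set x | y + s - h <= quad a N x <= y + s + 2 * h].
have mE : measurable E.
  rewrite (_ : E = quad a N @^-1` `[y + s - h, y + s + 2 * h]).
    by rewrite -[X in measurable X]setTI; exact: measurable_quad_seqspace.
  by apply/seteqP; split => x /=; rewrite in_itv.
have mU := measurable_quad a N.
have mS := measurable_quad a K.+1.
(* Off [T] the random part of the added term is at most |e| h A / s1, which is at most [h] because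
   |e| A = |s|. This is why the target interval is widened by [h] on each side. *)
pose T := [set w | h * A / s1 <= `|U a K.+1 w|].
have mT : measurable T by apply: measurable_event_ge; exact: measurableT_comp.
have mcE : measurable [set w | E (fun j => head_scale K e j * xi j w)].
  rewrite (_ : [set w | _] = [set w | y + s - h <=
     U a N w + e * (U a K.+1 w + A) <= y + s + 2 * h]).
    apply: measurable_event_itv; apply: measurable_funD => //.
    by apply: measurable_funM => //; apply: measurable_funD.
  by apply/seteqP; split => w /=; rewrite /E /= quad_head_scale.
apply: (@le_trans _ _ (pr [set w | E (fun j => head_scale K e j * xi j w)] + pr T)).
  apply: pr_leU => //; first exact: measurable_event_itv.
  move=> w /= /andP[yU Uy]; rewrite /T/= /E/= quad_head_scale//.
  have [|UT] := lerP (h * A / s1) `|quad a K.+1 (xi^~ w)|; first by right.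
  left; rewrite mulrDr -/A es.
  have : `|e * quad a K.+1 (xi^~ w)| <= h.
    rewrite normrM; apply: (@le_trans _ _ (`|e| * (h * A / s1))).
      by rewrite ler_wpM2l// ltW.
    rewrite mulrA mulrCA eA ler_pdivrMr// ler_wpM2l// ltW//.
  rewrite ler_norml => /andP[? ?]; lra.
apply: lerD.
  apply: le_trans (head_scaling_pr iid _ e2 l0 mE) _.
  by rewrite lerD2l ler_pM2r ?invr_gt0// ler_expR.
apply: le_trans (quad_abs_tail iid _ _ _) _.
  by move=> j j0; rewrite ger0_norm; case/andP: (a4 j j0).
rewrite ler_pM2l// ler_expR lerD2l ler_wpM2l//.
exact: le_trans (sum_sqr_head a KN) aV.
Qed.

End quadratic_form.

(** * Mass of intervals under the quadratic form *)

Section local_mass.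
Context {R : realType} {d : measure_display} {Omega : measurableType d}.
Variables (P : probability Omega R) (xi : nat -> Omega -> R).
Hypothesis iid : iid_std_normal P xi.
Local Notation pr A := (fine (P A)).
Local Notation U a N := (fun w => quad a N (fun j => xi j w)).

Lemma expR_eventually_small (c h eta : R) : 0 < h -> 0 < eta ->
  exists A0, forall A, A0 <= A -> expR (- (h * A) + c) <= eta.
Proof.
move=> h0 eta0; exists ((c - ln eta) / h) => A; rewrite ler_pdivrMr// => cA.
rewrite -[leRHS]lnK ?posrE// ler_expR; lra.
Qed.

(* Many disjoint translates of the interval carry comparable mass. *)
Lemma quad_anticoncentration (V D eta : R) : 0 < eta ->
  exists delta A0 : R, 0 < delta /\ forall a K N (y : R), admissible V D a K N ->
    A0 <= head_sum a K -> pr [set w | y <= U a N w <= y + delta] <= eta.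
Proof.
(* This [l] makes the dilation cost exp(D) / l equal to eta / 4 for shifts of size at most 1. *)
move=> eta0; pose l := 4 * expR D / eta.
have l0 : 0 < l by rewrite divr_gt0// mulr_gt0// expR_gt0.
pose n := (Num.truncn (4 * l / eta)).+1.
have n0 : 0 < n%:R :> R by rewrite ltr0n.
have ln : l / n%:R <= eta / 4.
  have ln' : 4 * l / eta <= n%:R by exact/ltW/truncnS_gt.
  by rewrite ler_pdivrMr//; move: ln'; rewrite ler_pdivrMr//; lra.
(* The interval is shifted by multiples of 4h and widened to length 3h, so the [n] translates are
   disjoint, and all shifts stay below 4hn = 1. *)
pose h : R := (4 * n%:R)^-1.
have h0 : 0 < h by rewrite invr_gt0 mulr_gt0.
have hn : 4 * h * n%:R = 1 by rewrite /h; field; rewrite gt_eqF.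
have [A0 A0P] := expR_eventually_small (4 * V) h0 (divr_gt0 eta0 (ltr0n R 8)).
exists h, (Num.max A0 2); split => // a K N y adm.
rewrite ge_max => /andP[/A0P errA A2].
set p := fine _.
pose B i := [set w | y + 4 * h * i%:R - h <= U a N w <= y + 4 * h * i%:R + 2 * h].
have mU := measurable_quad iid a N.
have step (i : 'I_n) : p <= l * pr (B i) + eta / 2.
  have s_ge0 : 0 <= 4 * h * i%:R by rewrite !mulr_ge0 ?ler0n// ltW.
  have s1 : `|4 * h * i%:R| <= 1.
    rewrite ger0_norm// -[leRHS]hn; apply: ler_wpM2l; last by rewrite ler_nat ltnW.
    by rewrite mulr_ge0// ltW.
  have A2' : 2 * 1 <= head_sum a K by rewrite mulr1.
  apply: le_trans (transport iid y adm l0 h0 ltr01 s1 A2') _.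
  rewrite divr1 expr1n mulr1 -addrA lerD2l.
  have -> : expR D / l = eta / 4.
    by rewrite /l; field; rewrite !gt_eqF ?expR_gt0.
  by move: errA; lra.
have : \sum_(i < n) p <= \sum_(i < n) (l * pr (B i) + eta / 2) by exact: ler_sum.
rewrite big_split/= -mulr_sumr !sumr_const card_ord -(mulr_natl p) -(mulr_natl (eta / 2)).
have B1 : \sum_(i < n) pr (B i) <= 1.
  apply: pr_sum_disjoint_le1 => [i|i j w /= /andP[i1 i2] /andP[j1 j2]].
    exact: measurable_event_itv.
  apply/eqP; rewrite eq_le; apply/andP; split; rewrite leNgt; apply/negP => ij.
    have : j%:R + 1 <= i%:R :> R by rewrite natr1 ler_nat.
    by move=> /(ler_wpM2l (ltW h0)); lra.
  have : i%:R + 1 <= j%:R :> R by rewrite natr1 ler_nat.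
  by move=> /(ler_wpM2l (ltW h0)); lra.
have := ler_wpM2l (ltW l0) B1; rewrite mulr1 => lB np.
(* Averaging over the translates: their masses sum to at most 1, so the main term is at most l / n,
   itself at most eta / 4. *)
have : p <= l / n%:R + eta / 2.
  by rewrite -(ler_pM2l n0) mulrDr mulrCA divff ?gt_eqF// mulr1; lra.
lra.
Qed.

(* Some interval of a fixed finite cover of [-r, r] has mass bounded below. *)
Lemma quad_local_mass (V D M h : R) : 0 <= M -> 0 < h ->
  exists gamma A0 : R, 0 < gamma /\ forall a K N (t : R), admissible V D a K N ->
    A0 <= head_sum a K -> `|t| <= M ->
    gamma <= pr [set w | t - h <= U a N w <= t].
Proof.
move=> M0 h0.
(* [r] is such that the form leaves [-r, r] with probability at most 1/2. *)
have [r0 r0P] := expR_eventually_small (4 * V) (@ltr01 R) (divr_gt0 (@ltr01 R) (ltr0n R 4)).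
pose r := Num.max r0 1; have r1 : 1 <= r by rewrite le_max lexx orbT.
have rP : expR (- r + 4 * V) <= 1 / 4.
  by have := r0P r; rewrite (mul1r r); apply; rewrite le_max lexx.
(* [transport] turns an interval of length [k] into one of length 3k, which has to be the target
   interval of length [h]. *)
pose k := h / 3; have k0 : 0 < k by rewrite divr_gt0.
pose n := (Num.truncn (2 * r / k)).+1.
have n0 : 0 < n%:R :> R by rewrite ltr0n.
have nk : 2 * r < n%:R * k by rewrite -ltr_pdivrMr//; exact: truncnS_gt.
have nk' : (n%:R - 1) * k <= 2 * r.
  rewrite -ler_pdivlMr// /n -natr1 addrK truncn_le.
  by rewrite divr_ge0 ?mulr_ge0// ltW//; lra.
(* Bounds every shift that carries a cell of the cover of [-r, r] onto the target interval, for all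
   |t| at most [M]. *)
pose s1 := M + h + r.
have s10 : 0 < s1 by rewrite /s1; lra.
pose c := expR (D * s1 ^+ 2); have c0 : 0 < c by exact: expR_gt0.
(* Summed over the [n] cells, the dilation cost is 1/8 and the tail error at most 1/8. Since the
   cells carry mass at least 1/2, there remains 1/4 <= n l q, where q is the mass of the target. *)
pose l := 8 * n%:R * c; have l0 : 0 < l by rewrite !mulr_gt0.
have ks0 : 0 < k / s1 by rewrite divr_gt0.
have e0 : 0 < (16 * n%:R : R)^-1 by rewrite invr_gt0 mulr_gt0.
have [A0 A0P] := expR_eventually_small (4 * V) ks0 e0.
exists (4 * n%:R * l)^-1, (Num.max A0 (2 * s1)); split.
  by rewrite invr_gt0 !mulr_gt0.
move=> a K N t adm; rewrite ge_max => /andP[/A0P errA A2] tM.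
set q := fine _; have mU := measurable_quad iid a N.
pose y i := - r + i%:R * k.
pose B i := [set w | y i <= U a N w <= y i + k].
have step (i : 'I_n) : pr (B i) <= l * q + c / l + 2 * (16 * n%:R)^-1.
  pose s := t - h + k - y i.
  have s_le : `|s| <= s1.
    have i0 : 0 <= i%:R * k by rewrite mulr_ge0 ?ler0n// ltW.
    have i1 : i%:R * k <= (n%:R - 1) * k.
      by rewrite ler_wpM2r ?(ltW k0)// lerBrDr natr1 ler_nat.
    move: tM; rewrite !ler_norml => /andP[tl tr].
    have kh : k = h / 3 by [].
    by rewrite /s /y /s1; apply/andP; split; lra.
  apply: le_trans (transport iid (y i) adm l0 k0 s10 s_le A2) _.
  rewrite /q (_ : y i + s - k = t - h); last by rewrite /s; ring.
  rewrite (_ : y i + s + 2 * k = t); last by rewrite /s /k; field.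
  rewrite lerD2l ler_pM2l//; apply: le_trans errA.
  by rewrite ler_expR lerD2r lerN2 mulrAC.
have bigT : 1 / 2 <= \sum_(i < n) pr (B i).
  pose T := [set w | r <= `|U a N w|].
  have mT : measurable T by apply: measurable_event_ge; exact: measurableT_comp.
  have prT : pr T <= 1 / 2.
    case: adm => a4 aV _ _.
    apply: le_trans (quad_abs_tail iid _ _ _) _.
      by move=> j j0; rewrite ger0_norm; case/andP: (a4 j j0).
    have : expR (- r + 4 * \sum_(1 <= j < N) a j ^+ 2) <= 1 / 4.
      by apply: le_trans rP; rewrite ler_expR lerD2l ler_wpM2l.
    lra.
  apply: (@le_trans _ _ (pr (~` T))); first by rewrite pr_setC//; lra.
  apply: pr_le_bigU; first exact: measurableC.
    by move=> i; exact: measurable_event_itv.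
  move=> w /= /negP; rewrite -ltNge ltr_norml => /andP[rU Ur].
  set u := quad _ _ _ in rU Ur.
  pose x := (u + r) / k.
  have x0 : 0 <= x by rewrite divr_ge0 ?(ltW k0)//; lra.
  have xk : x * k = u + r by rewrite divfK// gt_eqF.
  have tl : (Num.truncn x)%:R <= x by rewrite truncn_le.
  have tu : x < (Num.truncn x).+1%:R by exact: truncnS_gt.
  exists (Num.truncn x).
    by rewrite truncn_lt_nat// -(ltr_pM2r k0) xk; lra.
  rewrite /B/= -/u /y; move: tl tu; rewrite -natr1.
  move=> /(ler_wpM2r (ltW k0)) tl /ltW/(ler_wpM2r (ltW k0)) tu.
  by apply/andP; split; lra.
have := le_trans bigT (ler_sum _ (fun i _ => step i)).
rewrite sumr_const card_ord.
have -> : (l * q + c / l + 2 * (16 * n%:R)^-1) *+ n =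
    n%:R * l * q + 1 / 8 + 1 / 8.
  by rewrite -[LHS]mulr_natl /l; field; rewrite !gt_eqF.
move=> H; rewrite -[leLHS]mul1r ler_pdivrMr ?mulr_gt0//; lra.
Qed.

End local_mass.

(** * Effect of a linear form and a shift *)

Section shifted_form.
Context {R : realType} {d : measure_display} {Omega : measurableType d}.
Variables (P : probability Omega R) (xi : nat -> Omega -> R).
Hypothesis iid : iid_std_normal P xi.
Local Notation pr A := (fine (P A)).
Local Notation U a N := (fun w => quad a N (fun j => xi j w)).
Local Notation lin b N := (fun w => \sum_(1 <= j < N) b j * xi j w).

Lemma measurable_lin (b : nat -> R) N : measurable_fun setT (lin b N).
Proof.
apply: measurable_sum_nat => j; apply: measurable_funM => //.
exact: (iid_measurable iid j).
Qed.

Lemma lin_tail_scaled N (b : nat -> R) (x lam : R) : 0 < lam ->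
  pr [set w | x <= \sum_(1 <= j < N) b j * xi j w] <=
  expR (- (lam * x) + lam ^+ 2 * (\sum_(1 <= j < N) b j ^+ 2) / 2).
Proof.
move=> lam0; have := lin_tail iid N (fun j => lam * b j) (lam * x).
have -> : \sum_(1 <= j < N) (lam * b j) ^+ 2 / 2 =
    lam ^+ 2 * (\sum_(1 <= j < N) b j ^+ 2) / 2.
  by rewrite -mulr_suml mulr_sumr; congr (_ / _); apply: eq_bigr => j _; rewrite exprMn.
apply: le_trans; apply: pr_le.
- by apply: measurable_event_ge; exact: measurable_lin.
- by apply: measurable_event_ge; exact: (measurable_lin (fun j => lam * b j) N).
move=> w /= xw.
have -> : \sum_(1 <= j < N) lam * b j * xi j w = lam * \sum_(1 <= j < N) b j * xi j w.
  by rewrite mulr_sumr; apply: eq_bigr => j _; rewrite mulrA.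
by rewrite ler_pM2l.
Qed.

(** The linear form has variance at most [m], so for small [m] the sum of both perturbations rarely
    exceeds [del]. Otherwise the two events differ only when the form falls in an interval of length
    [del], and anticoncentration applies. *)
Lemma quad_shift_close (V D eta : R) : 0 < eta ->
  exists delta A0 : R, 0 < delta /\ forall a K N (b : nat -> R) (m t : R),
    admissible V D a K N -> A0 <= head_sum a K -> m <= delta ->
    \sum_(1 <= j < N) b j ^+ 2 <= m ->
    pr [set w | t < U a N w + lin b N w + m] <= pr [set w | t < U a N w] + eta.
Proof.
move=> eta0; have eta2 : 0 < eta / 2 by rewrite divr_gt0.
have [del [A0 [del0 A0P]]] := quad_anticoncentration iid V D eta2.
pose del' := del / 2; have del'0 : 0 < del' by rewrite divr_gt0.
have [l0 l0P] := expR_eventually_small 1 del'0 eta2.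
pose lam := Num.max l0 1; have lam1 : 1 <= lam by rewrite le_max lexx orbT.
have lam0 : 0 < lam by exact: lt_le_trans lam1.
have lamP : expR (- (del' * lam) + 1) <= eta / 2 by apply: l0P; rewrite le_max lexx.
(* Half of [del] is left to the shift and half to the linear form; the second bound keeps the
   variance term lam^2 m / 2 of the Chernoff exponent below 1. *)
exists (Num.min del' (2 / lam ^+ 2)), A0; split.
  by rewrite lt_min del'0 divr_gt0// exprn_gt0.
move=> a K N b m t adm hA; rewrite le_min => /andP[m1 m2] bm.
have mU := measurable_quad iid a N; have mL := measurable_lin b N.
have lm : lam ^+ 2 * m <= 2 by rewrite mulrC -ler_pdivlMr// exprn_gt0.
have tailL : pr [set w | del' <= lin b N w] <= eta / 2.
  apply: le_trans (lin_tail_scaled N b del' lam0) _.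
  apply: le_trans lamP; rewrite ler_expR (mulrC lam) lerD2l ler_pdivrMr// mul1r.
  apply: le_trans lm; rewrite ler_wpM2l// sqr_ge0//.
have acU := A0P a K N (t - del) adm hA.
apply: (@le_trans _ _ (pr [set w | t - del < U a N w] + pr [set w | del' <= lin b N w])).
  apply: pr_leU.
  - by apply: measurable_event_gt; do 2?apply: measurable_funD.
  - exact: measurable_event_gt.
  - exact: measurable_event_ge.
  move=> w /= tZ; have [Ld|Ld] := lerP del' (lin b N w); first by right.
  left; move: Ld tZ m1; rewrite /del'; lra.
have : pr [set w | t - del < U a N w] <= pr [set w | t < U a N w] +
    pr [set w | t - del <= U a N w <= t - del + del].
  apply: pr_leU.
  - exact: measurable_event_gt.
  - exact: measurable_event_gt.
  - exact: measurable_event_itv.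
  move=> w /= tU; have [Ut|Ut] := ltrP t (quad a N (xi^~ w)); [by left|right].
  by apply/andP; split; lra.
lra.
Qed.

(** The linear form rarely drops below -m/2. Otherwise the perturbed form can be below [t] only if
    the unperturbed one is below t - delta/2, and this misses the interval [t - delta/4, t], whose
    mass is bounded below. *)
Lemma quad_shift_separated (V D M delta : R) : 0 <= M -> 0 < delta ->
  exists gamma w0 A0 : R, [/\ 0 < gamma, 0 < w0 &
    forall a K N (b : nat -> R) (m t : R),
      admissible V D a K N -> A0 <= head_sum a K -> delta <= m ->
      \sum_(1 <= j < N) b j ^+ 2 <= w0 * m -> `|t| <= M ->
      pr [set w | U a N w + lin b N w + m <= t] + gamma <=
      pr [set w | U a N w <= t]].
Proof.
move=> M0 delta0; have d4 : 0 < delta / 4 by rewrite divr_gt0.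
have [g [A0 [g0 A0P]]] := quad_local_mass iid V D M0 d4.
have g2 : 0 < g / 2 by rewrite divr_gt0.
have [l0 l0P] := expR_eventually_small 0 d4 g2.
pose lam := Num.max l0 1; have lam1 : 1 <= lam by rewrite le_max lexx orbT.
have lam0 : 0 < lam by exact: lt_le_trans lam1.
have lamP : expR (- (delta / 4 * lam) + 0) <= g / 2.
  by apply: l0P; rewrite le_max lexx.
(* With this [w0] the Chernoff exponent -lam m/2 + lam^2 w0 m/2 equals -lam m/4. Half of the mass
   [g] pays for the linear form. *)
exists (g / 2), (2 * lam)^-1, A0; split => //.
  by rewrite invr_gt0 mulr_gt0.
move=> a K N b m t adm hA dm bm tM.
have mU := measurable_quad iid a N; have mL := measurable_lin b N.
have mass := A0P a K N t adm hA tM.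
have tailL : pr [set w | lin b N w <= - (m / 2)] <= g / 2.
  apply: (@le_trans _ _ (pr [set w | m / 2 <= \sum_(1 <= j < N) - b j * xi j w])).
    apply: pr_le.
    - exact: measurable_event_le.
    - by apply: measurable_event_ge; exact: (measurable_lin (fun j => - b j) N).
    move=> w /= Lm; rewrite (_ : \sum_(1 <= j < N) - b j * xi j w = - lin b N w).
      by rewrite lerNr.
    by rewrite -sumrN; apply: eq_bigr => j _; rewrite mulNr.
  apply: le_trans (lin_tail_scaled N (fun j => - b j) (m / 2) lam0) _.
  have -> : \sum_(1 <= j < N) (- b j) ^+ 2 = \sum_(1 <= j < N) b j ^+ 2.
    by apply: eq_bigr => j _; rewrite sqrrN.
  apply: le_trans lamP; rewrite ler_expR addr0.
  apply: (@le_trans _ _ (- (lam * (m / 2)) + lam ^+ 2 * ((2 * lam)^-1 * m) / 2)).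
    by rewrite lerD2l ler_pM2r ?invr_gt0// ler_wpM2l// sqr_ge0.
  have -> : - (lam * (m / 2)) + lam ^+ 2 * ((2 * lam)^-1 * m) / 2 = - (lam * m / 4).
    by field; rewrite gt_eqF.
  by have := ler_wpM2l (ltW lam0) dm; lra.
have step1 : pr [set w | U a N w + lin b N w + m <= t] <=
    pr [set w | U a N w <= t - delta / 2] + pr [set w | lin b N w <= - (m / 2)].
  apply: pr_leU.
  - by apply: measurable_event_le; do 2?apply: measurable_funD.
  - exact: measurable_event_le.
  - exact: measurable_event_le.
  move=> w /= Zt; have [Ld|Ld] := lerP (lin b N w) (- (m / 2)); first by right.
  left; move: Ld Zt dm; lra.
have step2 : pr [set w | U a N w <= t - delta / 2] +
    pr [set w | t - delta / 4 <= U a N w <= t] <= pr [set w | U a N w <= t].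
  apply: pr_geU.
  - exact: measurable_event_le.
  - exact: measurable_event_le.
  - exact: measurable_event_itv.
  - by move=> w /= [Ut|/andP[]//]; lra.
  - apply/seteqP; split => // w /= [U1 /andP[U2 _]]; lra.
lra.
Qed.

End shifted_form.

(** * Truncation of the test statistic *)

Section series_facts.
Context {R : realType}.

(** A strict lower bound on the series is attained by a partial sum. Since rejection is a strict
    inequality, it reduces to finite sums. *)
Lemma nneseries_EFin_gtP (u : nat -> R) (c : R) : (forall j, 0 <= u j) ->
  (c%:E < \sum_(1 <= j <oo) (u j)%:E)%E <->
  exists N, c < \sum_(1 <= j < N) u j.
Proof.
move=> u0; split => [cu|[N cN]]; last first.
  rewrite -lte_fin -sumEFin in cN; apply: lt_le_trans cN _.
  by apply: nneseries_lim_ge => j _ _; rewrite lee_fin.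
apply: contrapT => H; move: cu; apply/negP; rewrite -leNgt.
apply: lime_le; first by apply: is_cvg_nneseries => j _ _; rewrite lee_fin.
apply: nearW => N; rewrite sumEFin lee_fin leNgt; apply/negP => cN.
by apply: H; exists N.
Qed.

Lemma nneseries_EFin_leP (u : nat -> R) (c : R) : (forall j, 0 <= u j) ->
  (\sum_(1 <= j <oo) (u j)%:E <= c%:E)%E <->
  forall N, \sum_(1 <= j < N) u j <= c.
Proof.
move=> u0; split => [uc N|H].
  by rewrite leNgt; apply/negP => cN; move: uc; rewrite leNgt => /negP; apply;
    apply/nneseries_EFin_gtP => //; exists N.
rewrite leNgt; apply/negP => /nneseries_EFin_gtP => /(_ u0)[N].
by rewrite ltNge H.
Qed.

Lemma ge0_sum_nat_le (u : nat -> R) m N N' : (forall j, 0 <= u j) ->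
  (N <= N')%N -> \sum_(m <= j < N) u j <= \sum_(m <= j < N') u j.
Proof.
move=> u0 NN; have [mN|Nm] := leqP m N; last first.
  by rewrite big_geq ?sumr_ge0// ltnW.
by rewrite (big_cat_nat mN NN)/= lerDl sumr_ge0.
Qed.

Lemma nneseries_EFin_cvg (u : nat -> R) (s : R) : (forall j, 0 <= u j) ->
  (\sum_(1 <= j <oo) (u j)%:E = s%:E)%E ->
  (fun N => \sum_(1 <= j < N) u j) @ \oo --> s.
Proof.
move=> u0 us; apply/cvgrPdist_le => eps eps0.
have [N sN] : exists N, s - eps < \sum_(1 <= j < N) u j.
  by apply/nneseries_EFin_gtP => //; rewrite us lte_fin; lra.
have le_s M : \sum_(1 <= j < M) u j <= s.
  by move: M; apply/nneseries_EFin_leP => //; rewrite us.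
exists N => // M /= NM; rewrite ger0_norm ?subr_ge0//.
by have := ge0_sum_nat_le 1 u0 NM; lra.
Qed.

End series_facts.

Section truncation.
Context {R : realType} {d : measure_display} {Omega : measurableType d}.
Variables (P : probability Omega R) (xi : nat -> Omega -> R).
Hypothesis iid : iid_std_normal P xi.
Variables (sigma : R) (kap2 : nat -> nat -> R).
Hypothesis sigma0 : 0 < sigma.
Hypothesis kap0 : forall n j, 0 <= kap2 n j.
Local Notation pr A := (fine (P A)).
Local Notation U a N := (fun w => quad a N (fun j => xi j w)).
Local Notation lin b N := (fun w => \sum_(1 <= j < N) b j * xi j w).

(* n^2 T_n = sum_j weight_j (xi_j^2 - 1) + sum_j cross_j xi_j + sum_j signal_j *)
Definition weight n j : R := n%:R * sigma ^+ 2 * kap2 n j.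
Definition cross n (th : nat -> R) j : R :=
  n%:R ^+ 2 * kap2 n j * th j * 2 * (sigma * (Num.sqrt n%:R)^-1).
Definition signal n (th : nat -> R) j : R := n%:R ^+ 2 * (kap2 n j * th j ^+ 2).

Lemma weight_ge0 n j : 0 <= weight n j.
Proof. by rewrite /weight !mulr_ge0 ?ler0n// ltW. Qed.

Lemma signal_ge0 n th j : 0 <= signal n th j.
Proof. by rewrite /signal mulr_ge0 ?sqr_ge0// mulr_ge0 ?sqr_ge0. Qed.

(** The variance of the linear form is thus controlled by the total signal times the largest
    weight. *)
Lemma cross_sqr n th j : (0 < n)%N ->
  cross n th j ^+ 2 = 4 * weight n j * signal n th j.
Proof.
move=> n0; have nR : (n%:R : R) != 0 by rewrite pnatr_eq0 -lt0n.
rewrite /cross; set q := sigma * _.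
have q2 : q ^+ 2 = sigma ^+ 2 / n%:R by rewrite exprMn exprVn sqr_sqrtr ?ler0n.
rewrite [LHS]exprMn q2 /weight /signal; field.
exact: nR.
Qed.

Lemma scaled_terms n th N w : (0 < n)%N ->
  n%:R ^+ 2 * \sum_(1 <= j < N)
    (kap2 n j * (th j + sigma * (Num.sqrt n%:R)^-1 * xi j w) ^+ 2) =
  U (weight n) N w + lin (cross n th) N w + \sum_(1 <= j < N) signal n th j +
  \sum_(1 <= j < N) weight n j.
Proof.
move=> n0; have nR : (n%:R : R) != 0 by rewrite pnatr_eq0 -lt0n.
rewrite mulr_sumr /quad -!big_split/=; apply: eq_bigr => j _.
set q := sigma * _.
have q2 : q ^+ 2 = sigma ^+ 2 / n%:R by rewrite exprMn exprVn sqr_sqrtr ?ler0n.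
transitivity (n%:R ^+ 2 * kap2 n j * (th j ^+ 2 + 2 * th j * q * xi j w +
   q ^+ 2 * xi j w ^+ 2)); first by ring.
rewrite q2 /cross -/q /weight /signal; field.
exact: nR.
Qed.

(** The statistic is centred by all of [rho], whereas [quad] centres only the terms below [N]; the
    difference is moved into the threshold. When [rho] is finite, the level decreases to n^2 t as
    [N] grows. *)
Definition trunc_level n t N : R :=
  n%:R ^+ 2 * t + n%:R * sigma ^+ 2 * fine (rho kap2 n) -
  \sum_(1 <= j < N) weight n j.

Definition trunc_reject n t th N : set Omega :=
  [set w | trunc_level n t N < U (weight n) N w + lin (cross n th) N w +
    \sum_(1 <= j < N) signal n th j].

Lemma measurable_trunc_reject n t th N : measurable (trunc_reject n t th N).
Proof.
apply: measurable_event_gt; apply: measurable_funD => //.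
by apply: measurable_funD; [exact: (measurable_quad iid)|exact: (measurable_lin iid)].
Qed.

Let noisy n th w j := kap2 n j * (th j + sigma * (Num.sqrt n%:R)^-1 * xi j w) ^+ 2.

Let noisy_ge0 n th w j : 0 <= noisy n th w j.
Proof. by rewrite /noisy mulr_ge0 ?sqr_ge0. Qed.

Let trunc_rejectE n t th N w : (0 < n)%N -> trunc_reject n t th N w <->
  t + sigma ^+ 2 / n%:R * fine (rho kap2 n) < \sum_(1 <= j < N) noisy n th w j.
Proof.
move=> n0; have nR : (0 : R) < n%:R by rewrite ltr0n.
have n2 : (0 : R) < n%:R ^+ 2 by rewrite exprn_gt0.
rewrite -(ltr_pM2l n2) /noisy scaled_terms// /trunc_reject/= /trunc_level.
rewrite ltrBlDr mulrDr; suff -> : n%:R ^+ 2 * (sigma ^+ 2 / n%:R * fine (rho kap2 n)) =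
  n%:R * sigma ^+ 2 * fine (rho kap2 n) by [].
by field; rewrite gt_eqF.
Qed.

Lemma rejectE n t th : (0 < n)%N ->
  reject xi sigma kap2 n t th = \bigcup_N trunc_reject n t th N.
Proof.
move=> n0; apply/seteqP; split => w.
  rewrite /reject/= /Tstat lteBrDr// -EFinD => /nneseries_EFin_gtP.
  move=> /(_ (noisy_ge0 n th w))[N tN].
  by exists N => //; apply/trunc_rejectE.
move=> [N _ /(trunc_rejectE t th N w n0) tN]; rewrite /reject/= /Tstat lteBrDr// -EFinD.
apply/(nneseries_EFin_gtP _ (noisy_ge0 n th w)); by exists N.
Qed.

Lemma measurable_reject n t th : (0 < n)%N ->
  measurable (reject xi sigma kap2 n t th).
Proof.
move=> n0; rewrite rejectE//; apply: bigcup_measurable => N _.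
exact: measurable_trunc_reject.
Qed.

(** The truncated rejection regions increase with [N], so this is continuity of [P] from below. It
    transfers bounds uniform in [N] to the full statistic. *)
Lemma trunc_reject_cvg n t th : (0 < n)%N ->
  (fun N => pr (trunc_reject n t th N)) @ \oo -->
  pr (reject xi sigma kap2 n t th).
Proof.
move=> n0; apply: fine_cvg; rewrite fineK; last first.
  by apply: fin_num_measure; exact: measurable_reject.
rewrite rejectE//; apply: (@nondecreasing_cvg_mu _ _ _ P).
- by move=> N; exact: measurable_trunc_reject.
- by rewrite -rejectE//; exact: measurable_reject.
move=> N N' NN; apply/subsetPset => w /(trunc_rejectE t th N w n0) tN.
apply/(trunc_rejectE t th N' w n0); apply: lt_le_trans tN _.
exact: ge0_sum_nat_le (noisy_ge0 n th w) NN.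
Qed.

Let trunc_reject_diff_cvg n t th : (0 < n)%N ->
  (fun N => pr (trunc_reject n t th N) - pr (trunc_reject n t (fun=> 0) N)) @ \oo
  --> (pr (reject xi sigma kap2 n t th) -
       pr (reject xi sigma kap2 n t (fun=> 0)) : R).
Proof. by move=> n0; apply: cvgB; exact: trunc_reject_cvg. Qed.

Lemma trunc_reject0 n t N :
  trunc_reject n t (fun=> 0) N = [set w | trunc_level n t N < U (weight n) N w].
Proof.
rewrite /trunc_reject; apply/seteqP; split => w /=;
  rewrite [X in _ + X]big1 ?addr0 => [|j _]; rewrite ?[X in _ + X]big1 ?addr0 // => *;
  by rewrite /signal /cross ?expr0n/= !(mulr0, mul0r).
Qed.

Lemma trunc_level_cvg n t : (rho kap2 n < +oo)%E ->
  trunc_level n t N @[N --> \oo] --> n%:R ^+ 2 * t.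
Proof.
move=> rhooo.
have rhoE : rho kap2 n = (fine (rho kap2 n))%:E.
  by rewrite fineK// ge0_fin_numE// nneseries_ge0// => j _ _; rewrite lee_fin.
have /= := @nneseries_EFin_cvg _ (kap2 n) (fine (rho kap2 n)) (kap0 n) rhoE.
move=> cv; rewrite [X in _ --> X](_ : _ = n%:R ^+ 2 * t +
   n%:R * sigma ^+ 2 * fine (rho kap2 n) -
   n%:R * sigma ^+ 2 * fine (rho kap2 n)); last by rewrite addrK.
apply: cvgB; first exact: cvg_cst.
rewrite (_ : (fun N => _) =
  (fun N => n%:R * sigma ^+ 2 * \sum_(1 <= j < N) kap2 n j)); last first.
  by apply/funext => N; rewrite mulr_sumr.
apply: cvgM => //; exact: cvg_cst.
Qed.

Lemma reject_close (V D eta : R) : 0 < eta ->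
  exists delta A0 : R, 0 < delta /\ forall n K (t : R) th, (0 < n)%N ->
    (forall N, (K < N)%N -> admissible V D (weight n) K N) ->
    A0 <= head_sum (weight n) K ->
    (\sum_(1 <= j <oo) (signal n th j)%:E <= delta%:E)%E ->
    pr (reject xi sigma kap2 n t th) <=
    pr (reject xi sigma kap2 n t (fun=> 0)) + eta.
Proof.
move=> eta0; have [del [A0 [del0 H]]] := quad_shift_close iid V D eta0.
exists del, A0; split => // n K t th n0 adm hA.
move=> /(nneseries_EFin_leP _ (signal_ge0 n th)) sh.
rewrite -lerBlDl.
have cv := @trunc_reject_diff_cvg n t th n0.
apply: (cvgr_to_le cv).
exists K.+1 => // N /= KN; rewrite trunc_reject0 lerBlDl.
apply: (H _ K) => //; first exact: adm.
(* Weights at most 1/4 cancel the factor 4 in [cross_sqr]. *)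
apply: ler_sum_nat => j /andP[j1 _]; rewrite cross_sqr// ler_piMl ?signal_ge0//.
by case: (adm N KN) => a4 _ _ _; have /andP[_] := a4 j j1; lra.
Qed.

Lemma reject_separated (V D M delta : R) : 0 <= M -> 0 < delta ->
  exists gamma w0 A0 : R, [/\ 0 < gamma, 0 < w0 &
    forall n K (t : R) th, (0 < n)%N -> (rho kap2 n < +oo)%E ->
      (forall N, (K < N)%N -> admissible V D (weight n) K N) ->
      (forall j, (0 < j)%N -> weight n j <= w0) ->
      A0 <= head_sum (weight n) K -> `|n%:R ^+ 2 * t| <= M ->
      (delta%:E < \sum_(1 <= j <oo) (signal n th j)%:E)%E ->
      pr (reject xi sigma kap2 n t (fun=> 0)) + gamma <=
      pr (reject xi sigma kap2 n t th)].
Proof.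
move=> M0 delta0.
(* The truncated level is within 1 of n^2 t for large [N], hence the margin. *)
have M1 : 0 <= M + 1 by lra.
have [g [w0 [A0 [g0 w00 H]]]] := quad_shift_separated iid V D M1 delta0.
(* The division by 4 absorbs the factor 4 in [cross_sqr]. *)
exists g, (w0 / 4), A0; split => //; first by rewrite divr_gt0.
move=> n K t th n0 rhooo adm ww hA tM.
move=> /(nneseries_EFin_gtP _ (signal_ge0 n th))[N0 shN0].
rewrite -lerBrDl.
have cv := @trunc_reject_diff_cvg n t th n0.
apply: (cvgr_to_ge cv).
have /cvgrPdist_le/(_ 1 ltr01)[N1 _ HN1] := @trunc_level_cvg n t rhooo.
exists (maxn (maxn K.+1 N0) N1) => // N /=; rewrite !geq_max => /andP[/andP[KN N0N] N1N].
rewrite trunc_reject0 lerBrDl.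
have lev : `|trunc_level n t N| <= M + 1.
  have := HN1 N N1N; rewrite /= => lev1.
  rewrite (_ : trunc_level n t N = n%:R ^+ 2 * t - (n%:R ^+ 2 * t - trunc_level n t N));
    last by ring.
  by apply: le_trans (ler_normB _ _) _; exact: lerD.
have mU := measurable_quad iid (weight n) N.
have mZ : measurable_fun setT (fun w => U (weight n) N w + lin (cross n th) N w +
    \sum_(1 <= j < N) signal n th j).
  by apply: measurable_funD => //; apply: measurable_funD => //; exact: (measurable_lin iid).
have CE (F : Omega -> R) (x : R) : [set w | F w <= x] = ~` [set w | x < F w].
  by apply/seteqP; split => w /=; rewrite leNgt => /negP.
have sep : pr (~` trunc_reject n t th N) + g <=
    pr (~` [set w | trunc_level n t N < U (weight n) N w]).
  rewrite -!CE; apply: (H _ K) => //; first exact: adm.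
    by apply/ltW/(lt_le_trans shN0); exact: ge0_sum_nat_le (signal_ge0 n th) N0N.
  rewrite mulr_sumr; apply: ler_sum_nat => j /andP[j1 _]; rewrite cross_sqr//.
  by rewrite ler_wpM2r ?signal_ge0//; have := ww j j1; lra.
move: sep; rewrite !pr_setC; first by lra.
- exact: measurable_event_gt.
- exact: measurable_trunc_reject.
Qed.

End truncation.

(** * Orders of magnitude under A1-A5 *)

Section regime.
Context {R : realType}.
Variables (sigma r : R) (kap2 : nat -> nat -> R) (k : nat -> nat).
Hypothesis sigma0 : 0 < sigma.
Hypothesis kap0 : forall n j, 0 <= kap2 n j.
Hypothesis kn : forall n, (0 < n)%N -> kn_spec kap2 n (k n).
Hypothesis hA1 : A1 kap2.
Hypothesis hA2 : A2 sigma kap2.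
Hypothesis hA3 : A3 r kap2.
Hypothesis hA5 : A5 kap2 k.

Local Notation w := (weight sigma kap2).
Local Notation A n := (head_sum (w n) (k n)).

Lemma rho_fin n : (0 < n)%N -> (rho kap2 n < +oo)%E.
Proof.
case: hA3 => c1 [c2 [_ [_ H]]] n0; have /andP[_ h] := H n n0.
exact: le_lt_trans h (ltry _).
Qed.

Lemma kn_gt0 n : (0 < n)%N -> (0 < k n)%N.
Proof.
move=> n0; have [_] := kn n0; apply; rewrite big_geq// divr_ge0//.
by apply/fine_ge0/nneseries_ge0 => j _ _; rewrite lee_fin.
Qed.

Lemma partial_sum_le_rho n N : (0 < n)%N ->
  \sum_(1 <= j < N) kap2 n j <= fine (rho kap2 n).
Proof.
move=> n0; move: N; apply/nneseries_EFin_leP => //; rewrite fineK//.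
by rewrite ge0_fin_numE ?rho_fin// nneseries_ge0// => j _ _; rewrite lee_fin.
Qed.

Lemma head_sumE n : A n = n%:R * sigma ^+ 2 * \sum_(1 <= j < (k n).+1) kap2 n j.
Proof. by rewrite /head_sum mulr_sumr. Qed.

(** Maximality of [k n]: since [head_sum] includes the index [k n] itself, it exceeds half of the
    total. *)
Lemma head_sum_gt_rho n : (0 < n)%N ->
  n%:R * sigma ^+ 2 * (fine (rho kap2 n) / 2) < A n.
Proof.
move=> n0; rewrite head_sumE ltr_pM2l; last by rewrite mulr_gt0 ?ltr0n ?exprn_gt0.
rewrite ltNge; apply/negP => /(kn n0).2.
by rewrite ltnn.
Qed.

Lemma sum_weight_le n N : (0 < n)%N -> \sum_(1 <= j < N) w n j <= 2 * A n.
Proof.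
move=> n0; have := head_sum_gt_rho n0; rewrite -mulr_sumr.
have := ler_wpM2l (_ : 0 <= n%:R * sigma ^+ 2) (partial_sum_le_rho N n0).
by move=> /(_ (mulr_ge0 (ler0n _ _) (sqr_ge0 _))); lra.
Qed.

Lemma weight_homo n i j : (0 < i)%N -> (i <= j)%N -> w n j <= w n i.
Proof.
move=> i0 ij; apply: ler_wpM2l; last exact: hA1.
by rewrite mulr_ge0 ?ler0n ?sqr_ge0.
Qed.

Lemma weight_le1 n j : (0 < j)%N -> w n j <= w n 1.
Proof.
exact: weight_homo.
Qed.

(** By A5 the weights w_1 and w_K, K = [k n], are comparable, and A lies between K w_K and K w_1. By
    A2, K w_K^2 is bounded, hence so is w_1 A; also the sum of squared weights is bounded below and
    at most 2 w_1 A, so K = O(A^2). By A3, A has the order of n^(1-2r), which fixes the order of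
    kappa_n^2. *)
Lemma regime_constants : exists V D B b : R, [/\ 0 < V, 0 < B, 0 < b &
  forall n, (0 < n)%N -> [/\
    forall N, \sum_(1 <= j < N) w n j ^+ 2 <= V,
    (k n)%:R <= D * A n ^+ 2,
    b * (n%:R * npow n (-2 * r)) <= A n,
    w n 1 * A n <= B &
    b <= n%:R ^+ 2 * npow n (-2 * r) * kap2 n (k n) <= B]].
Proof.
case: hA2 => C1 [C2 [C10 H2]]; case: hA3 => c1 [c2 [c10 [c20 H3]]].
case: hA5 => -[c [C [c0 [C0 H5]]]] _.
have s8 : 0 < sigma ^+ 8 by rewrite exprn_gt0.
have s2 : 0 < sigma ^+ 2 by rewrite exprn_gt0.
have C20 : 0 < C2.
  have /andP[h1 h2] := H2 1%N isT.
  by have := lt_trans h1 h2; rewrite lte_fin; lra.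
pose V := sigma ^+ 8 * C2; pose v := sigma ^+ 8 * C1.
have V0 : 0 < V by rewrite mulr_gt0.
have v0 : 0 < v by rewrite mulr_gt0.
pose B1 := C ^+ 2 * V; have B10 : 0 < B1 by rewrite mulr_gt0// exprn_gt0.
pose b1 := sigma ^+ 2 * c1 / 2; have b10 : 0 < b1 by rewrite !mulr_gt0.
(* From v <= 2 C w_K A and the upper bound of A in terms of n^(1-2r). *)
pose b2 := v / (2 * C * sigma ^+ 2 * (sigma ^+ 2 * c2)).
have b20 : 0 < b2 by rewrite divr_gt0// !mulr_gt0.
(* From w_1 A <= B1 and the lower bound [b1] of A in terms of n^(1-2r). *)
pose B2 := B1 / (sigma ^+ 2 * b1).
have B20 : 0 < B2 by rewrite divr_gt0// mulr_gt0.
exists V, (2 * C / v), (Num.max B1 B2), (Num.min b1 b2); split => //.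
- by rewrite lt_max B10.
- by rewrite lt_min b10.
move=> n n0; have nR : (0 : R) < n%:R by rewrite ltr0n.
set p := npow n (-2 * r).
have p0 : 0 < p by exact: powR_gt0.
have k0 := kn_gt0 n0; have kR : (0 : R) < (k n)%:R by rewrite ltr0n.
have sqE N : \sum_(1 <= j < N) w n j ^+ 2 =
    sigma ^+ 8 * \sum_(1 <= j < N) (sigma ^- 4 * n%:R ^+ 2 * kap2 n j ^+ 2).
  rewrite mulr_sumr; apply: eq_bigr => j _; rewrite /weight; field.
  by rewrite gt_eqF.
have serE : ((sigma ^- 4 * n%:R ^+ 2)%:E * \sum_(1 <= j <oo) (kap2 n j ^+ 2)%:E =
    \sum_(1 <= j <oo) (sigma ^- 4 * n%:R ^+ 2 * kap2 n j ^+ 2)%:E)%E.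
  rewrite -nneseriesZl; last by move=> j _; rewrite lee_fin sqr_ge0.
  by apply: eq_eseriesr => j _; rewrite -EFinM.
have term0 j : 0 <= sigma ^- 4 * n%:R ^+ 2 * kap2 n j ^+ 2.
  by rewrite mulr_ge0 ?sqr_ge0// mulr_ge0 ?sqr_ge0// invr_ge0 exprn_ge0// ltW.
have := H2 n n0; rewrite serE => /andP[lowS /ltW upS].
have VP N : \sum_(1 <= j < N) w n j ^+ 2 <= V.
  rewrite sqE ler_pM2l//; move: N; exact/nneseries_EFin_leP.
have [N1 vN1] : exists N, v < \sum_(1 <= j < N) w n j ^+ 2.
  have [N hN] := (nneseries_EFin_gtP C1 term0).1 lowS.
  by exists N; rewrite sqE ltr_pM2l.
have w0 j : 0 <= w n j by exact: weight_ge0.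
have A0 : 0 < A n.
  apply: le_lt_trans (head_sum_gt_rho n0).
  apply: mulr_ge0; first exact: ltW (mulr_gt0 nR s2).
  apply: divr_ge0 => //.
  by apply/fine_ge0/nneseries_ge0 => j _ _; rewrite lee_fin.
have /andP[H5l H5u] := H5 n n0.
have wK : w n 1 <= C * w n (k n).
  by rewrite mulrCA ler_wpM2l// mulr_ge0 ?ler0n ?sqr_ge0.
have vA : v <= 2 * (w n 1 * A n).
  apply/ltW/(lt_le_trans vN1).
  apply: (@le_trans _ _ (w n 1 * \sum_(1 <= j < N1) w n j)).
    rewrite mulr_sumr; apply: ler_sum_nat => j /andP[j1 _].
    by rewrite expr2 ler_wpM2r// weight_le1.
  by rewrite mulrCA ler_wpM2l// sum_weight_le.
have sumK (x : R) : \sum_(1 <= j < (k n).+1) x = (k n)%:R * x.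
  by rewrite sumr_const_nat subSS subn0 mulr_natl.
have KwA : (k n)%:R * w n (k n) <= A n.
  rewrite -sumK; apply: ler_sum_nat => j /andP[j1 j2].
  exact: weight_homo.
have AKw : A n <= (k n)%:R * w n 1.
  by rewrite -sumK; apply: ler_sum_nat => j /andP[j1 _]; exact: weight_le1.
have KwV : (k n)%:R * w n (k n) ^+ 2 <= V.
  apply: le_trans (VP (k n).+1); rewrite -sumK; apply: ler_sum_nat => j /andP[j1 j2].
  rewrite ler_sqr ?nnegrE//; exact: weight_homo.
have wAB : w n 1 * A n <= B1.
  apply: (@le_trans _ _ (w n 1 * ((k n)%:R * w n 1))); first by rewrite ler_wpM2l.
  rewrite mulrCA -expr2; apply: (@le_trans _ _ ((k n)%:R * (C * w n (k n)) ^+ 2)).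
    by rewrite ler_wpM2l ?ler0n// ler_sqr ?nnegrE// mulr_ge0// ltW.
  by rewrite exprMn mulrCA ler_wpM2l ?sqr_ge0.
have rhoE : (fine (rho kap2 n))%:E = rho kap2 n.
  by rewrite fineK// ge0_fin_numE ?rho_fin// nneseries_ge0// => j _ _; rewrite lee_fin.
have /andP[rl ru] := H3 n n0; rewrite -rhoE lee_fin in rl; rewrite -rhoE lee_fin in ru.
have Al : b1 * (n%:R * p) <= A n.
  apply/ltW/(le_lt_trans _ (head_sum_gt_rho n0)).
  have := ler_wpM2l (ltW (mulr_gt0 nR s2)) rl; rewrite -/p /b1; lra.
have Au : A n <= sigma ^+ 2 * c2 * (n%:R * p).
  rewrite head_sumE.
  have := ler_wpM2l (ltW (mulr_gt0 nR s2)) (le_trans (partial_sum_le_rho (k n).+1 n0) ru).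
  by rewrite -/p; lra.
have EK : n%:R ^+ 2 * p * kap2 n (k n) = (n%:R * p) * w n (k n) / sigma ^+ 2.
  by rewrite /weight; field; rewrite gt_eqF.
split => //.
- rewrite mulrAC ler_pdivlMr//.
  apply: (@le_trans _ _ ((k n)%:R * (2 * (C * w n (k n) * A n)))).
    rewrite ler_wpM2l ?ler0n//; apply: le_trans vA _.
    by rewrite ler_wpM2l// ler_wpM2r// ltW.
  have CA0 : 0 <= 2 * C * A n by rewrite mulr_ge0 ?mulr_ge0// ltW.
  by have := ler_wpM2l CA0 KwA; lra.
- by apply: le_trans Al; rewrite ler_wpM2r ?mulr_ge0 ?ler0n ?(ltW p0)// ge_min lexx.
- by apply: le_trans wAB _; rewrite le_max lexx.
rewrite EK; apply/andP; split.
  apply: (@le_trans _ _ b2); first by rewrite ge_min lexx orbT.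
  rewrite ler_pdivlMr// /b2 mulrAC ler_pdivrMr ?mulr_gt0//.
  have h1 : v <= 2 * C * w n (k n) * (sigma ^+ 2 * c2 * (n%:R * p)).
    have Cw0 : 0 <= C * w n (k n) by rewrite mulr_ge0// ltW.
    have h1a := ler_wpM2r (ltW A0) wK; have h1b := ler_wpM2l Cw0 Au.
    by move: h1a h1b vA; lra.
  have := ler_wpM2r (ltW s2) h1; lra.
apply: (@le_trans _ _ B2); last by rewrite le_max lexx orbT.
rewrite ler_pdivrMr// (_ : B2 * sigma ^+ 2 = B1 / b1); last first.
  by rewrite /B2; move: b10; generalize B1 b1 => B b b0; field; rewrite !gt_eqF.
rewrite ler_pdivlMr// mulrC mulrA; apply: le_trans wAB; rewrite mulrC.
by apply: ler_pM => //; [rewrite !mulr_ge0// ltW|exact: weight_le1].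
Qed.

(** The condition r < 1/2 makes the exponent 1 - 2r positive; this is what drives A to infinity. *)
Lemma npow_growth (X : R) : r < 2^-1 -> exists n0, forall n, (n0 < n)%N ->
  X <= n%:R * npow n (-2 * r).
Proof.
move=> r2; pose e := 1 - 2 * r; have e0 : 0 < e by rewrite /e; lra.
pose Y := Num.max X 1; have Y1 : 1 <= Y by rewrite le_max lexx orbT.
have Y0 : 0 <= Y by lra.
exists (Num.truncn (Y `^ e^-1)) => n nY.
have n0 : (0 < n)%N by exact: leq_ltn_trans nY.
have nR : (0 : R) < n%:R by rewrite ltr0n.
have -> : n%:R * npow n (-2 * r) = n%:R `^ e.
  rewrite /npow -{1}(powRr1 (ltW nR)) -powRD; last by rewrite (gt_eqF nR) implybT.
  by congr (_ `^ _); rewrite /e; lra.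
apply: (@le_trans _ _ Y); first by rewrite le_max lexx.
have -> : Y = (Y `^ e^-1) `^ e by rewrite -powRrM mulVf ?gt_eqF// powRr1.
apply: ge0_ler_powR; rewrite ?nnegrE ?powR_ge0 ?(ltW e0) ?(ltW nR)//.
by apply/ltW/(lt_le_trans (truncnS_gt _)); rewrite ler_nat.
Qed.

End regime.

(** * From error probabilities to consistency *)

Section extended_limits.
Context {R : realType}.
Local Open Scope ereal_scope.

Lemma limn_esup_le (u : nat -> \bar R) (c : \bar R) (i0 : nat) :
  (forall i, (i0 <= i)%N -> u i <= c) -> limn_esup u <= c.
Proof.
move=> uc; rewrite limn_esup_lim; apply: lime_le; first exact: is_cvg_esups.
exists i0 => // i /= i0i; apply: ge_ereal_sup => _ [j /= ij <-].
by apply: uc; exact: leq_trans i0i ij.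
Qed.

Lemma limn_einf_ge (u : nat -> \bar R) (c : \bar R) (i0 : nat) :
  (forall i, (i0 <= i)%N -> c <= u i) -> c <= limn_einf u.
Proof.
by move=> cu; rewrite leeNr; apply: (@limn_esup_le _ _ i0) => i /cu; rewrite leeN2.
Qed.

End extended_limits.

Section errors.
Context {R : realType} {d : measure_display} {Omega : measurableType d}.
Variables (P : probability Omega R) (xi : nat -> Omega -> R).
Hypothesis iid : iid_std_normal P xi.
Variables (sigma r : R) (kap2 : nat -> nat -> R) (k : nat -> nat).
Hypothesis sigma0 : 0 < sigma.
Hypothesis kap0 : forall n j, 0 <= kap2 n j.
Hypothesis r_half : r < 2^-1.
Hypothesis kn : forall n, (0 < n)%N -> kn_spec kap2 n (k n).
Hypothesis hA1 : A1 kap2.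
Hypothesis hA2 : A2 sigma kap2.
Hypothesis hA3 : A3 r kap2.
Hypothesis hA5 : A5 kap2 k.
Local Notation pr A := (fine (P A)).
Local Notation rej := (reject xi sigma kap2).
Local Notation w := (weight sigma kap2).
Local Notation A n := (head_sum (w n) (k n)).

Lemma null_upper_tail (V : R) n (t : R) : (0 < n)%N -> (forall j, (0 < j)%N -> w n j <= 4^-1) ->
  (forall N, \sum_(1 <= j < N) w n j ^+ 2 <= V) ->
  pr (rej n t (fun=> 0)) <= expR (- (n%:R ^+ 2 * t) + 4 * V).
Proof.
move=> n0 w4 wV; have w0 := weight_ge0 sigma0 kap0 n.
apply: (cvgr_to_le (@trunc_reject_cvg _ _ _ P xi iid sigma kap2 kap0 n t (fun=> 0) n0)).
apply: nearW => N; rewrite trunc_reject0.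
have mU := measurable_quad iid (w n) N.
apply: (@le_trans _ _ (pr [set om | n%:R ^+ 2 * t <= quad (w n) N (xi^~ om)])).
  apply: pr_le; [exact: measurable_event_gt|exact: measurable_event_ge|].
  move=> om /= /ltW; apply: le_trans; rewrite /trunc_level -addrA lerDl subr_ge0.
  rewrite -mulr_sumr; apply: ler_wpM2l; first by rewrite mulr_ge0 ?ler0n ?sqr_ge0.
  exact: (partial_sum_le_rho kap0 hA3).
apply: le_trans (quad_tail iid N _ _) _; first by move=> j j0; rewrite ger0_norm// w4.
by rewrite ler_expR lerD2l ler_wpM2l.
Qed.

(** The tail bound is applied to the negated weights. The 1 in the exponent covers the distance of
    the truncated level from n^2 t. *)
Lemma null_lower_tail (V : R) n (t : R) : (0 < n)%N -> (forall j, (0 < j)%N -> w n j <= 4^-1) ->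
  (forall N, \sum_(1 <= j < N) w n j ^+ 2 <= V) ->
  1 - expR (n%:R ^+ 2 * t + 1 + 4 * V) <= pr (rej n t (fun=> 0)).
Proof.
move=> n0 w4 wV; have w0 := weight_ge0 sigma0 kap0 n.
apply: (cvgr_to_ge (@trunc_reject_cvg _ _ _ P xi iid sigma kap2 kap0 n t (fun=> 0) n0)).
have /cvgrPdist_le/(_ 1 ltr01)[N1 _ HN1] :=
  @trunc_level_cvg _ sigma kap2 kap0 n t (rho_fin hA3 n0).
exists N1 => // N /= N1N; rewrite trunc_reject0.
have mU := measurable_quad iid (w n) N.
have := HN1 N N1N; rewrite /= ler_distlC => /andP[_ lev].
have mE : measurable [set om | trunc_level sigma kap2 n t N < quad (w n) N (xi^~ om)].
  exact: measurable_event_gt.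
have := pr_setC P mE; set x := fine (P (~` _)) => xE.
suff : x <= expR (n%:R ^+ 2 * t + 1 + 4 * V) by lra.
apply: (@le_trans _ _ (pr [set om | - (n%:R ^+ 2 * t + 1) <=
    \sum_(1 <= j < N) - w n j * (xi j om ^+ 2 - 1)])).
  apply: pr_le; [exact: measurableC| |].
    by apply: measurable_event_ge; exact: (measurable_quad iid (fun j => - w n j)).
  move=> om /= /negP; rewrite -leNgt => h.
  have -> : \sum_(1 <= j < N) - w n j * (xi j om ^+ 2 - 1) = - quad (w n) N (xi^~ om).
    by rewrite /quad -sumrN; apply: eq_bigr => j _; rewrite mulNr.
  by rewrite lerN2; lra.
apply: le_trans (quad_tail iid N _ _) _.
  by move=> j j0; rewrite normrN ger0_norm// w4.
rewrite opprK ler_expR lerD2l ler_wpM2l//.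
by under eq_bigr do rewrite sqrrN.
Qed.

(** The exponential tails under the null force the scaled threshold of a test with level away from 0
    and 1 into a fixed interval, where [reject_separated] has a uniform gain. *)
Lemma level_bounded (V a : R) : 0 < a -> exists2 M : R, 0 <= M &
  forall n t, (0 < n)%N -> (forall j, (0 < j)%N -> w n j <= 4^-1) ->
    (forall N, \sum_(1 <= j < N) w n j ^+ 2 <= V) ->
    a <= pr (rej n t (fun=> 0)) <= 1 - a -> `|n%:R ^+ 2 * t| <= M.
Proof.
move=> a0; exists (`|4 * V| + 1 + `|ln a|).
  by rewrite !addr_ge0.
move=> n t n0 w4 wV /andP[al au].
have := le_trans al (null_upper_tail t n0 w4 wV).
have : a <= expR (n%:R ^+ 2 * t + 1 + 4 * V).
  by have := null_lower_tail t n0 w4 wV; lra.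
rewrite -{1 2}[a]lnK ?posrE// !ler_expR => h1 h2.
have v1 := ler_norm (4 * V); have v2 := ler_norm (- ln a); rewrite normrN in v2.
by rewrite ler_norml; apply/andP; split; lra.
Qed.

Definition diverges (ns : nat -> nat) :=
  forall X, exists i0, forall i, (i0 <= i)%N -> (X < ns i)%N.

(** [V] and [D] come first because the [w0] and [A0] of the comparison lemmas depend on them. The
    growth of A gives the second bound, and w_1 <= B / A the first. *)
Lemma eventually_admissible : exists V D : R,
  forall w0 A0 : R, 0 < w0 -> exists n0, forall n, (n0 < n)%N ->
    [/\ forall j, (0 < j)%N -> w n j <= Num.min w0 4^-1, A0 <= A n,
        forall N, \sum_(1 <= j < N) w n j ^+ 2 <= V &
        forall N, (k n < N)%N -> admissible V D (w n) (k n) N].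
Proof.
have [V [D [B [b [V0 B0 b0 H]]]]] :=
  regime_constants sigma0 kap0 kn hA1 hA2 hA3 hA5.
exists V, D => w1 A0 w10; pose w0 := Num.min w1 4^-1.
have w00 : 0 < w0 by rewrite lt_min w10 invr_gt0 ltr0n.
pose X := Num.max A0 (B / w0).
have [n0 n0P] := npow_growth (X / b) r_half.
exists n0 => n n0n; have npos : (0 < n)%N by exact: leq_ltn_trans n0n.
have [wV KD bA wA _] := H n npos.
have XA : X <= A n.
  by apply: le_trans bA; rewrite mulrC -ler_pdivrMr//; exact: n0P.
have := XA; rewrite ge_max => /andP[A0A BA].
have ww j : (0 < j)%N -> w n j <= w0.
  move=> j0; have Apos : 0 < A n by apply: lt_le_trans BA; rewrite divr_gt0.
  apply: le_trans (weight_le1 sigma hA1 n j0) _.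
  rewrite -(ler_pM2r Apos); apply: le_trans wA _.
  by rewrite -ler_pdivrMl// mulrC.
split => // N KN; split => // j j0.
by rewrite weight_ge0//= (le_trans (ww j j0))// ge_min lexx orbT.
Qed.

End errors.

Section consistency.
Context {R : realType} {d : measure_display} {Omega : measurableType d}.
Variables (P : probability Omega R) (xi : nat -> Omega -> R).
Hypothesis iid : iid_std_normal P xi.
Variables (sigma r : R) (kap2 : nat -> nat -> R) (k : nat -> nat).
Hypothesis sigma0 : 0 < sigma.
Hypothesis kap0 : forall n j, 0 <= kap2 n j.
Hypothesis r_half : r < 2^-1.
Hypothesis kn : forall n, (0 < n)%N -> kn_spec kap2 n (k n).
Hypothesis hA1 : A1 kap2.
Hypothesis hA2 : A2 sigma kap2.
Hypothesis hA3 : A3 r kap2.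
Hypothesis hA5 : A5 kap2 k.
Local Notation alpha := (alpha_err P xi sigma kap2).
Local Notation beta := (beta_err P xi sigma kap2).
Local Notation total_signal n th := (\sum_(1 <= j <oo) (signal kap2 n th j)%:E)%E.

Lemma beta_errE n t th : (0 < n)%N ->
  beta n t th = 1 - fine (P (reject xi sigma kap2 n t th)).
Proof. by move=> n0; rewrite /beta_err pr_setC//; exact: (measurable_reject iid). Qed.

Lemma power_gap (M delta : R) : 0 <= M -> 0 < delta ->
  exists2 gamma : R, 0 < gamma & exists n0, forall n t th, (n0 < n)%N ->
    `|n%:R ^+ 2 * t| <= M -> (delta%:E < total_signal n th)%E ->
    alpha n t + beta n t th <= 1 - gamma.
Proof.
move=> M0 delta0.
have [V [D H]] := eventually_admissible sigma0 kap0 r_half kn hA1 hA2 hA3 hA5.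
have [g [w0 [A0 [g0 w00 sep]]]] := reject_separated iid sigma kap0 V D M0 delta0.
have [n0 n0P] := H w0 A0 w00; exists g => //; exists n0 => n t th n0n tM sig.
have npos : (0 < n)%N by exact: leq_ltn_trans n0n.
have [ww AA wV adm] := n0P n n0n.
rewrite beta_errE// /alpha_err.
have sep2 : fine (P (reject xi sigma kap2 n t (fun=> 0))) + g <=
    fine (P (reject xi sigma kap2 n t th)).
  apply: (sep n (k n)) => //; first exact: rho_fin hA3 _ _.
  by move=> j j0; apply: le_trans (ww j j0) _; rewrite ge_min lexx.
lra.
Qed.

Lemma no_power (eta : R) : 0 < eta ->
  exists2 delta : R, 0 < delta & exists n0, forall n t th, (n0 < n)%N ->
    (total_signal n th <= delta%:E)%E -> 1 - eta <= alpha n t + beta n t th.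
Proof.
move=> eta0.
have [V [D H]] := eventually_admissible sigma0 kap0 r_half kn hA1 hA2 hA3 hA5.
have [del [A0 [del0 close]]] := reject_close iid sigma kap0 V D eta0.
have [n0 n0P] := H 1 A0 ltr01; exists del => //; exists n0 => n t th n0n sig.
have npos : (0 < n)%N by exact: leq_ltn_trans n0n.
have [ww AA wV adm] := n0P n n0n.
rewrite beta_errE// /alpha_err.
by have := close n (k n) t th npos adm AA sig; lra.
Qed.

(** Levels converging to [a] keep the scaled thresholds bounded, so the sum of the errors stays
    below 1 by a fixed gap, of which half survives the replacement of the level by [a]. *)
Lemma consistent_of_signal ns (g : nat -> nat -> R) (delta : R) i0 :
  diverges ns -> 0 < delta ->
  (forall i, (i0 <= i)%N -> (delta%:E < total_signal (ns i) (g i))%E) ->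
  consistent P xi sigma kap2 ns g.
Proof.
move=> dns delta0 sig a /andP[a0 a1] t acvg.
have [V [D H]] := eventually_admissible sigma0 kap0 r_half kn hA1 hA2 hA3 hA5.
have [n1 n1P] := H 1 0 ltr01.
(* A level within [a'] of [a] lies in [a', 1 - a']. *)
pose a' := Num.min (a / 2) ((1 - a) / 2).
have a'0 : 0 < a' by rewrite lt_min !divr_gt0// subr_gt0.
have [M M0 MP] := level_bounded iid sigma0 kap0 hA3 V a'0.
have [g0 gg0 [n2 n2P]] := power_gap M0 delta0.
pose e := Num.min a' (g0 / 2).
have e0 : 0 < e by rewrite lt_min a'0 divr_gt0.
have acvg' : (fun i => alpha (ns i) (t i)) @ \oo --> a.
  rewrite -[X in _ --> X](mul1r a).
  rewrite (_ : (fun i => _) = (fun i => alpha (ns i) (t i) / a * a)); last first.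
    by apply/funext => i; rewrite divfK ?gt_eqF.
  by apply: cvgM => //; exact: cvg_cst.
have /cvgrPdist_le/(_ e e0)[i1 _ i1P] := acvg'.
have [i2 i2P] := dns (maxn n1 n2).
apply: (@le_lt_trans _ _ (1 - a - g0 / 2)%:E); last by rewrite lte_fin; lra.
apply: (@limn_esup_le _ _ _ (maxn (maxn i0 i1) i2)) => i.
rewrite !geq_max => /andP[/andP[ii0 ii1] ii2].
have := i2P i ii2; rewrite gtn_max => /andP[nn1 nn2].
have npos : (0 < ns i)%N by exact: leq_ltn_trans nn1.
have [ww _ wV _] := n1P _ nn1.
have := i1P i ii1; rewrite /= ler_distlC => /andP[al au].
have aa : a' <= a / 2 /\ a' <= (1 - a) / 2.
  by split; rewrite /a' ge_min lexx ?orbT.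
have ee : e <= a' /\ e <= g0 / 2 by split; rewrite /e ge_min lexx ?orbT.
have tM : `|(ns i)%:R ^+ 2 * t i| <= M.
  apply: MP => //.
    by move=> j j0; apply: le_trans (ww j j0) _; rewrite ge_min lexx orbT.
  by rewrite -[fine _]/(alpha (ns i) (t i)); apply/andP; split; lra.
have := n2P _ (t i) (g i) nn2 tM (sig i ii0).
by rewrite lee_fin; lra.
Qed.

(** One test is enough: the zero threshold, whose scaled level is bounded for every sample size. *)
Lemma not_inconsistent_of_signal ns (g : nat -> nat -> R) (delta : R) i0 :
  diverges ns -> 0 < delta ->
  (forall i, (i0 <= i)%N -> (delta%:E < total_signal (ns i) (g i))%E) ->
  ~ inconsistent P xi sigma kap2 ns g.
Proof.
move=> dns delta0 sig /(_ (fun=> 0)).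
have [g0 gg0 [n2 n2P]] := power_gap (lexx 0) delta0.
have [i2 i2P] := dns n2.
apply/negP; rewrite -ltNge; apply: le_lt_trans (limn_einf_sup _) _.
apply: (@le_lt_trans _ _ (1 - g0)%:E); last by rewrite lte_fin; lra.
apply: (@limn_esup_le _ _ _ (maxn i0 i2)) => i; rewrite geq_max => /andP[ii0 ii2].
rewrite lee_fin; apply: n2P; [exact: i2P| |exact: sig].
by rewrite mulr0 normr0.
Qed.

Lemma inconsistent_of_signal ns (g : nat -> nat -> R) : diverges ns ->
  (forall delta : R, 0 < delta -> exists i0, forall i, (i0 <= i)%N ->
     (total_signal (ns i) (g i) <= delta%:E)%E) ->
  inconsistent P xi sigma kap2 ns g.
Proof.
move=> dns sig t; apply/lee_addgt0Pr => eta eta0.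
have [del del0 [n0 n0P]] := no_power eta0.
have [i0 i0P] := sig del del0; have [i1 i1P] := dns n0.
rewrite -leeBlDr// -EFinB; apply: (@limn_einf_ge _ _ _ (maxn i0 i1)) => i.
rewrite geq_max => /andP[ii0 ii1]; rewrite lee_fin; apply: n0P; first exact: i1P.
exact: i0P.
Qed.

End consistency.

(** * Heads and tails of an alternative and their signal *)

Section square_summable.
Context {R : realType}.
Implicit Types th f : nat -> R.

Lemma npow_gt0 n (a : R) : (0 < n)%N -> 0 < npow n a.
Proof. by move=> n0; apply: powR_gt0; rewrite ltr0n. Qed.

Lemma npow_sqr n (r : R) : (0 < n)%N -> npow n (- r) ^+ 2 = npow n (-2 * r).
Proof.
move=> n0; have := npow_gt0 (- r) n0; rewrite /npow => q0.
by rewrite -powR_mulrn ?ltW// -powRrM; congr (_ `^ _); ring.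
Qed.

Lemma sqsum_ge0 th : (0 <= sqsum th)%E.
Proof. by apply: nneseries_ge0 => j _ _; rewrite lee_fin sqr_ge0. Qed.

Lemma sqsumK th : is_l2 th -> (fine (sqsum th))%:E = sqsum th.
Proof. by move=> l2; rewrite fineK// ge0_fin_numE// sqsum_ge0. Qed.

Lemma is_l2P th : is_l2 th <-> exists C : R, forall N, \sum_(1 <= j < N) th j ^+ 2 <= C.
Proof.
split => [l2|[C HC]].
  exists (fine (sqsum th)); apply/nneseries_EFin_leP.
    by move=> j; exact: sqr_ge0.
  by rewrite sqsumK.
apply: (@le_lt_trans _ _ C%:E); last exact: ltry.
by apply/nneseries_EFin_leP => // j; exact: sqr_ge0.
Qed.

Lemma lt_l2normP th (a : R) : is_l2 th -> 0 <= a ->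
  a < l2norm th <-> exists N, a ^+ 2 < \sum_(1 <= j < N) th j ^+ 2.
Proof.
move=> l2 a0; rewrite -nneseries_EFin_gtP; last by move=> j; exact: sqr_ge0.
rewrite -[X in (_ < X)%E]/(sqsum th) -sqsumK// lte_fin /l2norm.
have S0 : 0 <= fine (sqsum th) by exact/fine_ge0/sqsum_ge0.
by rewrite -{2}(sqr_sqrtr S0) ltr_sqr ?nnegrE ?sqrtr_ge0.
Qed.

Lemma l2norm_le_partial th (a : R) N : is_l2 th -> 0 <= a -> l2norm th <= a ->
  \sum_(1 <= j < N) th j ^+ 2 <= a ^+ 2.
Proof.
move=> l2 a0 tha; rewrite leNgt; apply/negP => aN.
have : a < l2norm th by apply/lt_l2normP => //; exists N.
by rewrite ltNge tha.
Qed.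

Definition head_mass (X : R) N th : R :=
  \sum_(1 <= j < N) (if X < j%:R then 0 else th j ^+ 2).

Definition tail_mass (X : R) N th : R :=
  \sum_(1 <= j < N) (if X < j%:R then th j ^+ 2 else 0).

Lemma head_tail_mass X N th :
  head_mass X N th + tail_mass X N th = \sum_(1 <= j < N) th j ^+ 2.
Proof.
rewrite -big_split/=; apply: eq_bigr => j _.
by case: ifP; rewrite ?add0r ?addr0.
Qed.

Lemma tail_mass_le X Y N th : X <= Y -> tail_mass Y N th <= tail_mass X N th.
Proof.
move=> XY; apply: ler_sum => j _; case: ifPn => Yj.
  by rewrite (le_lt_trans XY Yj).
by case: ifP; rewrite ?sqr_ge0.
Qed.

(* Cauchy-Schwarz in the form x f <= x^2 + f^2/4 on the tail and
   x f <= s x^2 + f^2/(4 s) on the head *)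
Lemma head_mass_of_inner_product X N (x f : nat -> R) (s : R) : 0 < s ->
  \sum_(1 <= j < N) x j * f j <=
  tail_mass X N x + (\sum_(1 <= j < N) f j ^+ 2) / 4 +
  s * (\sum_(1 <= j < N) x j ^+ 2) + head_mass X N f / (4 * s).
Proof.
move=> s0; rewrite !mulr_suml mulr_sumr -!big_split/=; apply: ler_sum => j _.
have t1 : x j * f j <= x j ^+ 2 + f j ^+ 2 / 4.
  by have := sqr_ge0 (x j - f j / 2); nra.
have t2 : x j * f j <= s * x j ^+ 2 + f j ^+ 2 / (4 * s).
  have s4 : 0 < 4 * s by rewrite mulr_gt0.
  rewrite -(ler_pM2r s4) [leRHS]mulrDl divfK ?gt_eqF//.
  by have := sqr_ge0 (2 * s * x j - f j); nra.
have := sqr_ge0 (f j); have := mulr_ge0 (ltW s0) (sqr_ge0 (x j)).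
by case: ifP => _; rewrite ?mul0r; lra.
Qed.

End square_summable.

Section signal_bounds.
Context {R : realType}.
Variables (sigma r : R) (kap2 : nat -> nat -> R) (k : nat -> nat).
Hypothesis sigma0 : 0 < sigma.
Hypothesis kap0 : forall n j, 0 <= kap2 n j.
Hypothesis kn : forall n, (0 < n)%N -> kn_spec kap2 n (k n).
Hypothesis hA1 : A1 kap2.
Hypothesis hA2 : A2 sigma kap2.
Hypothesis hA3 : A3 r kap2.
Hypothesis hA4 : A4 kap2 k.
Hypothesis hA5 : A5 kap2 k.
Local Notation total_signal n th := (\sum_(1 <= j <oo) (signal kap2 n th j)%:E)%E.

(** On j <= C k_n, A1 and A5 keep kappa_nj^2 above a multiple of kappa_n^2, and n^2 n^(-2r)
    kappa_n^2 is bounded below. *)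
Lemma signal_of_head (C m : R) : 1 < C -> 0 < m ->
  exists2 delta : R, 0 < delta & forall n N th, (0 < n)%N ->
    m * npow n (-2 * r) <= head_mass (C * (k n)%:R) N th ->
    (delta%:E < total_signal n th)%E.
Proof.
move=> C1 m0; case: (hA5) => _ /(_ C C1)[c [c0 cP]].
have [V [D [B [b [V0 B0 b0 H]]]]] :=
  regime_constants sigma0 kap0 kn hA1 hA2 hA3 hA5.
have cmb : 0 < c * m * b by rewrite !mulr_gt0.
(* Halved to obtain a strict inequality. *)
exists (c * m * b / 2); first by rewrite divr_gt0.
move=> n N th n0 hm; apply/nneseries_EFin_gtP; first exact: signal_ge0.
exists N; apply: (@lt_le_trans _ _ (c * m * b)); first by lra.
have [_ _ _ _ /andP[bK _]] := H n n0.
have n2 : (0 : R) <= n%:R ^+ 2 by exact: sqr_ge0.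
have nk0 : 0 <= n%:R ^+ 2 * (c * kap2 n (k n)) by rewrite !mulr_ge0// ltW.
apply: (@le_trans _ _ (n%:R ^+ 2 * (c * kap2 n (k n)) * head_mass (C * (k n)%:R) N th)).
  have := ler_wpM2l nk0 hm.
  have := ler_wpM2l (ltW (mulr_gt0 c0 m0)) bK; lra.
rewrite mulr_sumr; apply: ler_sum_nat => j /andP[j1 _]; rewrite /signal.
rewrite -mulrA; apply: ler_wpM2l => //.
case: ifPn => [_|]; first by rewrite mulr0 mulr_ge0 ?sqr_ge0.
rewrite -leNgt => jC; apply: ler_wpM2r; first exact: sqr_ge0.
apply: le_trans (cP n n0) _; apply: hA1 => //.
by rewrite truncn_ge_nat// (le_trans _ jC) ?ler0n.
Qed.

(** Beyond (i+2) k_n, A1 and A4 bound kappa_nj^2 by a multiple of kappa_n^2 / (i+2), while n^2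
    n^(-2r) kappa_n^2 is bounded above. *)
Lemma signal_of_tail (C : R) : exists2 L : R, 0 <= L & forall n (i : nat) th f,
  (0 < n)%N -> is_l2 th -> 0 <= C -> l2norm th <= C * npow n (- r) ->
  (forall j, f j = if (i.+2%:R * (k n)%:R < j%:R :> R) then th j else 0) ->
  (total_signal n f <= (L / i.+2%:R)%:E)%E.
Proof.
case: hA4 => C4 [lam [C40 [lam1 H4]]].
have [V [D [B [b [V0 B0 b0 H]]]]] :=
  regime_constants sigma0 kap0 kn hA1 hA2 hA3 hA5.
have C4' := ltW C40; have B' := ltW B0.
exists (C4 * C ^+ 2 * B); first by rewrite mulr_ge0// mulr_ge0// sqr_ge0.
move=> n i th f n0 l2 C0 thC fE; apply/nneseries_EFin_leP; first exact: signal_ge0.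
move=> N; have [_ _ _ _ /andP[_ KB]] := H n n0.
have k0 := kn_gt0 kap0 kn n0.
have i0 : 0 < i.+2%:R :> R by rewrite ltr0n.
have kk : kap2 n (Num.truncn (i.+2%:R * (k n)%:R : R)) <= C4 / i.+2%:R * kap2 n (k n).
  (* A4 with delta = i+1, positive also for i = 0; as lam > 1 and i+2 >= 1, the power -lam is at
     most the power -1. *)
  have := H4 i.+1%:R n (ltr0Sn _ _) n0.
  rewrite -[1 + i.+1%:R]/(1%:R + i.+1%:R) -natrD add1n => /ltW h; apply: le_trans h _.
  apply: ler_wpM2r => //; apply: ler_wpM2l; first exact: ltW.
  rewrite -(powR_inv1 (ltW i0)); apply: ler_powR; last by lra.
  by rewrite -[1]/(1%:R) ler_nat.
apply: (@le_trans _ _ (n%:R ^+ 2 * (C4 / i.+2%:R * kap2 n (k n)) *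
    \sum_(1 <= j < N) th j ^+ 2)).
  rewrite mulr_sumr; apply: ler_sum_nat => j /andP[j1 _]; rewrite /signal fE.
  rewrite -mulrA; apply: ler_wpM2l; first exact: sqr_ge0.
  have kk0 : 0 <= C4 / i.+2%:R * kap2 n (k n).
    by rewrite mulr_ge0// divr_ge0// ltW.
  case: ifPn => [ij|_]; last by rewrite expr0n/= mulr0 mulr_ge0 ?sqr_ge0.
  apply: ler_wpM2r; first exact: sqr_ge0.
  apply: le_trans kk; apply: hA1.
    by rewrite truncn_gt0 -natrM -[1]/(1%:R) ler_nat muln_gt0.
  rewrite -(ler_nat R); apply: le_trans (ltW ij).
  by rewrite truncn_le mulr_ge0 ?ler0n.
have q0 := npow_gt0 (- r) n0.
have th2 := l2norm_le_partial N l2 (mulr_ge0 C0 (ltW q0)) thC.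
rewrite exprMn npow_sqr// in th2.
have cc : 0 <= n%:R ^+ 2 * (C4 / i.+2%:R * kap2 n (k n)).
  by rewrite mulr_ge0 ?sqr_ge0// mulr_ge0// divr_ge0// ltW.
have h1 := ler_wpM2l cc th2.
have cc2 : 0 <= C4 * C ^+ 2 / i.+2%:R.
  by rewrite divr_ge0 ?(ltW i0)// mulr_ge0 ?sqr_ge0.
have h2 := ler_wpM2l cc2 KB.
by move: h1 h2; generalize (i.+2%:R^-1 : R) => x h1 h2; lra.
Qed.

End signal_bounds.

(** * Pure consistency and uniformly small tails *)

Theorem theorem10 (R : realType) (d : measure_display) (Omega : measurableType d)
  (P : probability Omega R) (xi : nat -> Omega -> R)
  (sigma r : R) (kap2 : nat -> nat -> R) (k : nat -> nat)
  (th : nat -> nat -> R) :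
  iid_std_normal P xi ->
  0 < sigma -> 0 < r < 2^-1 ->
  (forall n j, 0 <= kap2 n j) ->
  (forall n, (0 < n)%N -> kn_spec kap2 n (k n)) ->
  A1 kap2 -> A2 sigma kap2 -> A3 r kap2 -> A4 kap2 k -> A5 kap2 k ->
  (exists c C : R, 0 < c < C /\
     forall n, (0 < n)%N ->
       is_l2 (th n) /\ c * npow n (- r) <= l2norm (th n) <= C * npow n (- r)) ->
  (purely_nr_consistent P xi sigma kap2 r th <->
   forall eps : R, 0 < eps ->
     exists (C1 : R) (n0 : nat), forall n, (n0 < n)%N ->
       (\sum_(1 <= j <oo)
          ((if C1 * (k n)%:R < j%:R then th n j ^+ 2 else 0)%:E)
        <= (eps * npow n (-2 * r))%:E)%E).
Proof.
move=> iid sigma0 /andP[r0 r2] kap0 kn hA1 hA2 hA3 hA4 hA5 [c [C [/andP[c0 cC] thP]]].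
have C0 : 0 < C by exact: lt_trans cC.
have tail0 (X : R) n j : 0 <= (if X < j%:R then th n j ^+ 2 else 0) by case: ifP; rewrite ?sqr_ge0.
split => [[_ pure] eps eps0|tailP].
- apply: contrapT => ntail; apply: pure.
  have next (q : R * nat) : exists n, (q.2 < n)%N /\
      ((eps * npow n (-2 * r))%:E <
       \sum_(1 <= j <oo) ((if q.1 * (k n)%:R < j%:R then th n j ^+ 2 else 0)%R%:E))%E.
    apply: contrapT => H; apply: ntail; exists q.1, q.2 => n qn.
    by rewrite leNgt; apply/negP => Hn; apply: H; exists n.
  have [f fP] := choice next.
  (* Each new sample size exceeds the previous one and has a tail beyond (i+2) k_n larger than eps
     n^(-2r). *)
  pose ns := fix ns i := if i is i'.+1 then f (i.+2%:R, ns i') else f (2, 0%N).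
  have nsP i : (0 < ns i)%N /\ exists N, eps * npow (ns i) (-2 * r) <
      tail_mass (i.+2%:R * (k (ns i))%:R) N (th (ns i)).
    have [m nsE] : exists m, ns i = f (i.+2%:R, m) by case: i => [|i]; eexists.
    have [fm] := fP (i.+2%:R, m); rewrite -nsE /= => /nneseries_EFin_gtP.
    move=> /(_ (tail0 _ _))[N HN]; split; last by exists N.
    by rewrite nsE; exact: leq_ltn_trans fm.
  have ns_step i : (ns i < ns i.+1)%N by have [] := fP (i.+3%:R, ns i).
  have ns_homo : {homo ns : m n / (m < n)%N >-> (m < n)%N}.
    by apply: homo_ltn => //; exact: ltn_trans.
  exists ns; split => //.
  (* Tail and head have disjoint supports, so orthogonality is termwise. *)
  pose f2 i j := if (i.+2%:R * (k (ns i))%:R : R) < j%:R then th (ns i) j else 0.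
  pose f1 i j := if (i.+2%:R * (k (ns i))%:R : R) < j%:R then 0 else th (ns i) j.
  have l2th i : is_l2 (th (ns i)) by have [n0 _] := nsP i; have [] := thP _ n0.
  have l2sub (g : nat -> R) i : (forall j, g j ^+ 2 <= th (ns i) j ^+ 2) -> is_l2 g.
    move=> gth; have /is_l2P[S HS] := l2th i; apply/is_l2P; exists S => N.
    by apply: le_trans (HS N); exact: ler_sum.
  have l2f2 i : is_l2 (f2 i).
    by apply: (l2sub _ i) => j; rewrite /f2; case: ifP; rewrite // expr0n sqr_ge0.
  exists (Num.sqrt eps), f1, f2; split; first by rewrite sqrtr_gt0.
  split=> [i|].
    have [n0 [N HN]] := nsP i.
    split.
      by apply: (l2sub _ i) => j; rewrite /f1; case: ifP; rewrite // expr0n sqr_ge0.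
    split; first exact: l2f2.
    split; first by move=> j _; rewrite /f1 /f2; case: ifP; rewrite ?add0r ?addr0.
    split.
      rewrite (_ : (fun N => _) = cst 0); first exact: cvg_cst.
      apply/funext => M; rewrite big1// => j _.
      by rewrite /f1 /f2; case: ifP; rewrite ?mul0r ?mulr0.
    have q0 := npow_gt0 (- r) n0.
    apply/lt_l2normP => //; first by rewrite mulr_ge0 ?sqrtr_ge0// ltW.
    exists N; rewrite exprMn sqr_sqrtr ?(ltW eps0)// npow_sqr//.
    apply: lt_le_trans HN _; apply: ler_sum => j _.
    by rewrite /f2; case: ifP; rewrite // expr0n.
  have dns : diverges ns.
    move=> X; exists X.+1 => i Xi; apply: leq_trans Xi _.
    by elim: i => // i IH; exact: leq_ltn_trans IH (ns_step i).
  apply: (inconsistent_of_signal iid sigma0 kap0 r2 kn hA1 hA2 hA3 hA5 dns).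
  have [L L0 LP] := signal_of_tail sigma0 kap0 kn hA1 hA2 hA3 hA4 hA5 C.
  move=> delta delta0; exists (Num.truncn (L / delta)) => i Li.
  have [n0 _] := nsP i; have [_ /andP[_ thC]] := thP _ n0.
  apply: le_trans (LP _ i _ (f2 i) n0 (l2th i) (ltW C0) thC _) _ => //.
  rewrite lee_fin ler_pdivrMr ?ltr0n// mulrC -ler_pdivrMr//.
  by apply/ltW/(lt_le_trans (truncnS_gt _)); rewrite ler_nat ltnS (leq_trans Li).
(* The cutoff is enlarged to exceed 1, as A5 requires of its constant; this only shrinks the
   tail. *)
have tail_bound eps : 0 < eps -> exists (C1 : R) n0, 1 < C1 /\ forall n N, (n0 < n)%N ->
    tail_mass (C1 * (k n)%:R) N (th n) <= eps * npow n (-2 * r).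
  move=> /tailP[C1 [n0 H]]; exists (Num.max C1 2), n0; split.
    by rewrite lt_max ltr1n orbT.
  move=> n N n0n; apply: le_trans (tail_mass_le _ _ (_ : C1 * (k n)%:R <= _)) _.
    by rewrite ler_wpM2r ?ler0n// le_max lexx.
  by move: N; apply/nneseries_EFin_leP => //; exact: H.
have id_diverges : diverges id by move=> X; exists X.+1.
split; first split.
(* Some partial sum of squares exceeds (c/2)^2 n^(-2r), with c/2 in place of c for strictness. A
   tail of at most c^2/8 leaves a head of at least c^2/8. *)
- have c8 : 0 < c ^+ 2 / 8 by rewrite divr_gt0// exprn_gt0.
  have [C1 [n0 [C11 H]]] := tail_bound _ c8.
  have [delta delta0 dP] := signal_of_head sigma0 kap0 kn hA1 hA2 hA3 hA5 C11 c8.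
  apply: (consistent_of_signal iid sigma0 kap0 r2 kn hA1 hA2 hA3 hA5 (i0 := n0.+1)
    id_diverges delta0) => n n0n.
  have npos : (0 < n)%N by exact: leq_ltn_trans n0n.
  have [l2 /andP[thc _]] := thP n npos; have q0 := npow_gt0 (- r) npos.
  have [N] : exists N, (c / 2 * npow n (- r)) ^+ 2 < \sum_(1 <= j < N) th n j ^+ 2.
    apply/lt_l2normP => //; first by rewrite mulr_ge0 ?divr_ge0// ltW.
    by apply: lt_le_trans thc; rewrite ltr_pM2r//; lra.
  rewrite exprMn npow_sqr// exprMn exprVn -(head_tail_mass (C1 * (k n)%:R)) => hN.
  by apply: (dP n N) => //; have := H n N n0n; lra.
(* The constants are relaxed because [nr_consistent] asks for strict bounds on the norm. *)
- exists (c / 2), (C + 1); split; first by apply/andP; split; lra.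
  move=> n npos; have [l2 /andP[thc thC]] := thP n npos; split => //.
  have q0 := npow_gt0 (- r) npos; apply/andP; split.
    by apply: lt_le_trans thc; rewrite ltr_pM2r//; lra.
  by apply: le_lt_trans thC _; rewrite ltr_pM2r//; lra.
move=> [ns [ns_homo [c1 [f1 [f2 [c10 [fP incons]]]]]]].
have ns_ge i : (i <= ns i)%N.
  by elim: i => // i IH; exact: leq_ltn_trans IH (ns_homo _ _ (ltnSn i)).
have dns : diverges ns.
  by move=> X; exists X.+1 => i Xi; exact: leq_trans Xi (ns_ge i).
have c12 : 0 < c1 ^+ 2 by rewrite exprn_gt0.
have e8 : 0 < c1 ^+ 2 / 8 by rewrite divr_gt0.
(* With this weight the term s |f_n|^2 of [head_mass_of_inner_product] costs at most c1^2/8 n^(-2r),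
   as much as the tail of f_n. *)
pose s := c1 ^+ 2 / (8 * C ^+ 2).
have C2 : 0 < C ^+ 2 by rewrite exprn_gt0.
have s0 : 0 < s by rewrite divr_gt0// mulr_gt0.
have sC : s * C ^+ 2 = c1 ^+ 2 / 8 by rewrite /s; field; rewrite gt_eqF.
have [C1 [n0 [C11 H]]] := tail_bound _ e8.
have [delta delta0 dP] := signal_of_head sigma0 kap0 kn hA1 hA2 hA3 hA5 C11
  (mulr_gt0 s0 c12).
apply: (not_inconsistent_of_signal iid sigma0 kap0 r2 kn hA1 hA2 hA3 hA5 (i0 := n0.+1)
    dns delta0 _ incons) => i n0i.
have n0n : (n0 < ns i)%N by exact: leq_trans n0i (ns_ge i).
have npos : (0 < ns i)%N by exact: leq_ltn_trans n0n.
set n := ns i in n0n npos *.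
have [l2 /andP[_ thC]] := thP n npos; have q0 := npow_gt0 (- r) npos.
have p0 := npow_gt0 (-2 * r) npos; set p := npow n (-2 * r) in p0 *.
have [_ [l2f2 [thE [orth normf2]]]] := fP i.
have [N0] : exists N, (c1 * npow n (- r)) ^+ 2 < \sum_(1 <= j < N) f2 i j ^+ 2.
  by apply/lt_l2normP => //; rewrite mulr_ge0// ltW.
rewrite exprMn npow_sqr// -/p => f2N0.
(* Orthogonality is a limit of partial sums, so a finite [N] leaves an error, here at most c1^2/4
   n^(-2r). *)
have e4 : 0 < c1 ^+ 2 / 4 * p by rewrite mulr_gt0// divr_gt0.
have /cvgrPdist_le/(_ _ e4)[N1 _ HN1] := orth.
pose N := maxn N0 N1.
have orthN : - (c1 ^+ 2 / 4 * p) <= \sum_(1 <= j < N) f1 i j * f2 i j.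
  have := HN1 N (leq_maxr _ _); rewrite /= sub0r normrN ler_norml => /andP[] //.
have f2N : c1 ^+ 2 * p <= \sum_(1 <= j < N) f2 i j ^+ 2.
  apply/ltW/(lt_le_trans f2N0); apply: ge0_sum_nat_le (leq_maxl _ _).
  by move=> j; exact: sqr_ge0.
have ip : \sum_(1 <= j < N) th n j * f2 i j =
    \sum_(1 <= j < N) f1 i j * f2 i j + \sum_(1 <= j < N) f2 i j ^+ 2.
  rewrite -big_split/=; apply: eq_big_nat => j /andP[j1 _].
  by rewrite thE// mulrDl expr2.
have thN : \sum_(1 <= j < N) th n j ^+ 2 <= C ^+ 2 * p.
  have := l2norm_le_partial N l2 (mulr_ge0 (ltW C0) (ltW q0)) thC.
  by rewrite exprMn npow_sqr.
have := head_mass_of_inner_product (C1 * (k n)%:R) N (th n) (f2 i) s0.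
have := H n N n0n; rewrite -/p ip => tl cs.
have sX := ler_wpM2l (ltW s0) thN; rewrite mulrA sC in sX.
have s4 : 0 < 4 * s by rewrite mulr_gt0.
apply: (dP n N) => //; rewrite -/p.
(* The inner product is at least |f_2n|^2 - c1^2 p/4 and the bound above spends |f_2n|^2/4 + c1^2
   p/8 + c1^2 p/8 outside the head. As |f_2n|^2 >= c1^2 p, at least (3/4 - 1/2) c1^2 p remains. *)
have : c1 ^+ 2 * p / 4 <= head_mass (C1 * (k n)%:R) N (f2 i) / (4 * s) by lra.
by rewrite ler_pdivlMr//; lra.
Qed.
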